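(* The graphs $G_{E_8}$ and $\overline{\Gamma}_1$ (the complement of $\Gamma_1$) are quantum isomorphic, non-isomorphic strongly regular graphs.
   Context: The $E_8$ root system $\Psi_{E_8}\subset\mathbb{R}^8$ consists of the 240 vectors $\pm e_i\pm e_j$ ($1\le i<j\le 8$) and all $x\in\{\pm1\}^8$ with $\prod_i x_i=1$. $G_{E_8}$ is the graph with vertices $v_x$, $x\in\Psi_{E_8}$, where $v_x=v_{-x}$ (120 vertices), and $v_x\sim v_y$ iff $\langle x,y\rangle=0$. The folded halved 8-cube graph has as vertices the pairs $\{x,\mathbf{1}+x\}$ for $x\in\mathbb{F}_2^8$ with $\sum_ix_i=0$ ($\mathbf{1}$ the all-ones vector), two vertices $\{x,\mathbf{1}+x\},\{y,\mathbf{1}+y\}$ being adjacent iff $x+y$ or $x+y+\mathbf{1}$ has exactly two nonzero coordinates. The graph $\Gamma_1$ (Brouwer–Ivanov–Klin) has as vertices one orbit of the independent sets of size 8 of the folded halved 8-cube graph under the group $\mathbb{Z}_2^6\times A_8$ (generated by translations by even-weight vectors and even permutations of the 8 coordinates), namely the orbit of size 120 considered by Brouwer, Ivanov and Klin; two vertices are adjacent iff the corresponding independent sets have exactly two points in common. A graph is strongly regular with parameters $(n,k,\lambda,\mu)$ if it has $n$ vertices, is $k$-regular, adjacent vertices have $\lambda$ common neighbours and distinct non-adjacent vertices have $\mu$ common neighbours. A quantum permutation matrix over a unital $C^*$-algebra $\mathcal{A}$ is $u=(u_{ij})\in M_n(\mathcal{A})$ with $u_{ij}=u_{ij}^*=u_{ij}^2$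 and $\sum_ku_{ik}=1=\sum_ku_{ki}$ for all $i$. Graphs $G_1,G_2$ on $n$ vertices are quantum isomorphic if there is a unital $C^*$-algebra $\mathcal{A}$ and a quantum permutation matrix $u\in M_n(\mathcal{A})$ with $A_{G_1}u=uA_{G_2}$, where $A_G$ denotes the adjacency matrix. *)

(* Defs.v *)
From HB Require Import structures.
From mathcomp Require Import all_boot all_order all_algebra all_fingroup.
From mathcomp Require Import complex Rstruct.
Set Implicit Arguments. Unset Strict Implicit. Unset Printing Implicit Defensive.
Import Order.TTheory GRing.Theory Num.Theory.
Local Open Scope ring_scope.

Definition RR : rcfType := Rdefinitions.R.
Definition CC : numClosedFieldType := RR[i].

Record cstar_algebra := CStarAlgebra {
  cs_alg :> algType CC;
  cs_star : cs_alg -> cs_alg;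
  cs_norm : cs_alg -> RR;
  cs_starD : forall a b : cs_alg, cs_star (a + b) = cs_star a + cs_star b;
  cs_starZ : forall (c : CC) (a : cs_alg), cs_star (c *: a) = Num.conj c *: cs_star a;
  cs_starM : forall a b : cs_alg, cs_star (a * b) = cs_star b * cs_star a;
  cs_starK : forall a : cs_alg, cs_star (cs_star a) = a;
  cs_norm_ge0 : forall a : cs_alg, 0 <= cs_norm a;
  cs_norm_eq0 : forall a : cs_alg, cs_norm a = 0 -> a = 0;
  cs_normD : forall a b : cs_alg, cs_norm (a + b) <= cs_norm a + cs_norm b;
  cs_normZ : forall (c : CC) (a : cs_alg), cs_norm (c *: a) = ComplexField.Normc.normc (c : RR[i]) * cs_norm a;
  cs_normM : forall a b : cs_alg, cs_norm (a * b) <= cs_norm a * cs_norm b;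
  cs_normC : forall a : cs_alg, cs_norm (cs_star a * a) = cs_norm a ^+ 2;
  cs_complete : forall u : nat -> cs_alg,
    (forall e : RR, 0 < e -> exists N : nat, forall m n : nat,
        (N <= m)%N -> (N <= n)%N -> cs_norm (u m - u n) < e) ->
    exists l : cs_alg, forall e : RR, 0 < e -> exists N : nat, forall n : nat,
        (N <= n)%N -> cs_norm (u n - l) < e
}.

Definition quantum_perm_matrix (A : cstar_algebra) (V1 V2 : finType)
    (u : V1 -> V2 -> A) : Prop :=
  (forall i j, u i j = cs_star (u i j)) /\
  (forall i j, u i j * u i j = u i j) /\
  (forall i, \sum_(k : V2) u i k = 1) /\
  (forall j, \sum_(k : V1) u k j = 1).

Definition quantum_isomorphic (V1 V2 : finType) (e1 : rel V1) (e2 : rel V2) : Prop :=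
  #|V1| = #|V2| /\
  exists (A : cstar_algebra) (u : V1 -> V2 -> A),
    quantum_perm_matrix u /\
    forall (i : V1) (j : V2),
      \sum_(k : V1) (e1 i k)%:R * u k j = \sum_(l : V2) u i l * (e2 l j)%:R.

Definition isomorphic (V1 V2 : finType) (e1 : rel V1) (e2 : rel V2) : Prop :=
  exists f : V1 -> V2, bijective f /\ forall x y, e1 x y = e2 (f x) (f y).

Definition srg_with (V : finType) (e : rel V) (n k l m : nat) : Prop :=
  [/\ #|V| = n,
      forall x, #|[set y | e x y]| = k,
      forall x y, x != y -> e x y -> #|[set z | e x z && e y z]| = l &
      forall x y, x != y -> ~~ e x y -> #|[set z | e x z && e y z]| = m].

Definition strongly_regular (V : finType) (e : rel V) : Prop :=
  exists n k l m, srg_with e n k l m.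

Definition complement (V : finType) (e : rel V) : rel V :=
  fun x y => (x != y) && ~~ e x y.

(* Every root of E8 has all coordinates in {-1,0,1}; a coordinate is
   encoded by t : 'I_3 with value t - 1. *)
Definition e8vec := {ffun 'I_8 -> 'I_3}.
Definition coord (t : 'I_3) : int := (t : nat)%:Z - 1.

Definition e8_root (x : e8vec) : bool :=
  (#|[set i | coord (x i) != 0]| == 2)%N
  || ([forall i, coord (x i) != 0] && (\prod_(i < 8) coord (x i) == 1)).

Definition e8neg (x : e8vec) : e8vec := [ffun i => rev_ord (x i)].

Definition e8inner (x y : e8vec) : int := \sum_(i < 8) coord (x i) * coord (y i).

Definition e8_vertex (S : {set e8vec}) : bool :=
  [exists x, e8_root x && (S == [set x; e8neg x])].

Definition GE8 := {S : {set e8vec} | e8_vertex S}.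

Definition GE8_adj : rel GE8 :=
  fun S T => [exists x in val S, exists y in val T, e8inner x y == 0].

Definition bvec := {ffun 'I_8 -> bool}.
Definition weight (x : bvec) : nat := #|[set i | x i]|.
Definition evenv (x : bvec) : bool := ~~ odd (weight x).
Definition addv (x y : bvec) : bvec := [ffun i => x i (+) y i].
Definition onev : bvec := [ffun => true].

Definition fh_vertex (S : {set bvec}) : bool :=
  [exists x, evenv x && (S == [set x; addv onev x])].

Definition fh_adj (S T : {set bvec}) : bool :=
  [exists x in S, exists y in T,
     (weight (addv x y) == 2)%N || (weight (addv (addv x y) onev) == 2)%N].

Definition indep8 (I : {set {set bvec}}) : bool :=
  [&& I \subset [set S | fh_vertex S], #|I| == 8 &
      [forall S in I, forall T in I, ~~ fh_adj S T]].

(* the element of Z_2^6 x A_8 given by an even permutation s and an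
   even-weight translation t acts by x |-> s.x + t *)
Definition gmap (s : {perm 'I_8}) (t : bvec) (x : bvec) : bvec :=
  addv [ffun i => x (s^-1 i)%g] t.

Definition gact (s : {perm 'I_8}) (t : bvec) (I : {set {set bvec}}) : {set {set bvec}} :=
  [set [set gmap s t x | x in S] | S : {set bvec} in I].

Definition orbitG (I : {set {set bvec}}) : {set {set {set bvec}}} :=
  [set gact st.1 st.2 I | st in [set st : {perm 'I_8} * bvec | ~~ odd_perm st.1 && evenv st.2]].

Definition Gamma1 (I0 : {set {set bvec}}) := {I : {set {set bvec}} | I \in orbitG I0}.

Definition Gamma1_adj (I0 : {set {set bvec}}) : rel (Gamma1 I0) :=
  fun I J => #|val I :&: val J| == 2.

(* Main.v *)
From Stdlib Require Import BinInt.
From Stdlib Require Rcomplete.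
Require Import Defs.
From HB Require Import structures.
From mathcomp Require Import all_boot all_order all_algebra all_fingroup.
From mathcomp Require Import complex Rstruct.
From mathcomp Require boolp classical_sets reals.
From mathcomp Require Import ring ssrZ.
Set Implicit Arguments. Unset Strict Implicit. Unset Printing Implicit Defensive.
Import Order.TTheory GRing.Theory Num.Theory.
Import Defs.

(* Let Q be F_2^6 with the quadratic form of plus type: the even words of length 8 modulo
   the all-one word, with q(x) = wt(x)/2 mod 2. An independent 8-set of the folded halved
   8-cube is a coset of a totally singular 3-space of Q. There are 30 such 3-spaces; A_8 has
   two orbits of 15 on them, exchanged by the odd permutations, and two distinct members of
   one orbit meet in a line {0, w}. So a vertex of Gamma_1 is a pair of one of 15 spaces U
   and a character of U, and vertices on distinct spaces are adjacent in the complement of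
   Gamma_1 iff their characters differ at w.

   The elements of Q also index the three-qubit Pauli matrices up to sign, and singular
   vectors correspond to real symmetric ones. Each U gives a commuting family, hence an
   orthogonal frame of R^8, and the 15 frames consist of the 120 lines of E8. A line is thus
   a pair of a space U and a system of signs on U, and lines of distinct frames are
   orthogonal iff their signs differ at w. The signs are not characters but form a torsor
   under them; the matrix with entry (U, chi), (U, psi) equal to the projection onto the
   line of signs chi psi is a quantum permutation matrix over M_8(C), and it intertwines
   the two graphs because both sides of the relation are spectral projections of the
   Pauli matrix of w.

   The graphs are not isomorphic: the common neighbours of two distinct non-orthogonal
   lines of E8 are all orthogonal to a third line, the one spanned by the sum or the
   difference of the roots, and no such third vertex exists in the complement of
   Gamma_1. *)

(** * The C*-algebra of complex matrices *)

Section MatrixCstar.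
Import boolp classical_sets reals.
Local Open Scope ring_scope.
Local Open Scope complex_scope.
Import ComplexField.Normc.
Variable R : realType.
Local Notation C := R[i].

Lemma normc_ge0 (z : C) : 0 <= normc z.
Proof. by case: z => a b; rewrite sqrtr_ge0. Qed.

Lemma normc_conj (z : C) : normc (Num.conj z) = normc z.
Proof. by case: z => a b; rewrite /normc /= sqrrN. Qed.

Lemma normc_sqr (z : C) : (normc z ^+ 2)%:C = Num.conj z * z.
Proof. by rewrite rmorphXn /= mulrC -normCK. Qed.

Lemma normc_sum (I : finType) (F : I -> C) :
  normc (\sum_i F i) <= \sum_i normc (F i).
Proof.
elim/big_ind2: _ => [|x1 x2 y1 y2 h1 h2|//]; first by rewrite normc0.
exact: le_trans (le_normcD _ _) (lerD h1 h2).
Qed.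

(** Lagrange's identity: the double sum of the squares (a_i b_j - a_j b_i)^2 is twice the gap in the
    squared inequality. *)
Lemma cauchy_schwarz (I : finType) (a b : I -> R) :
  \sum_i a i * b i <=
  Num.sqrt (\sum_i a i ^+ 2) * Num.sqrt (\sum_i b i ^+ 2).
Proof.
have sq_ge0 (f : I -> R) : 0 <= \sum_i f i ^+ 2.
  by apply: sumr_ge0 => i _; rewrite sqr_ge0.
rewrite -sqrtrM //; apply: le_trans (ler_norm _) _; rewrite -sqrtr_sqr ler_wsqrtr //.
have : 0 <= \sum_i \sum_j (a i * b j - a j * b i) ^+ 2.
  by apply: sumr_ge0 => i _; apply: sumr_ge0 => j _; rewrite sqr_ge0.
have -> : \sum_i \sum_j (a i * b j - a j * b i) ^+ 2 =
    ((\sum_i a i ^+ 2) * (\sum_j b j ^+ 2) - (\sum_i a i * b i) ^+ 2) *+ 2.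
  have e1 : \sum_i \sum_j a i ^+ 2 * b j ^+ 2 = (\sum_i a i ^+ 2) * (\sum_j b j ^+ 2).
    by rewrite big_distrlr.
  have e2 : \sum_i \sum_j (a i * b i) * (a j * b j) = (\sum_i a i * b i) ^+ 2.
    by rewrite expr2 big_distrlr.
  have e3 : \sum_i \sum_j a j ^+ 2 * b i ^+ 2 = (\sum_i a i ^+ 2) * (\sum_j b j ^+ 2).
    by rewrite exchange_big.
  rewrite mulrnBl -e2 mulr2n -{1}e1 -e3 -big_split -sumrMnl -sumrB /=.
  apply: eq_bigr => i _; rewrite -big_split -sumrMnl -sumrB /=.
  by apply: eq_bigr => j _; ring.
by rewrite pmulrn_lge0 // subr_ge0.
Qed.

(** * The Euclidean norm on complex column vectors *)

Section Vectors.
Variable n : nat.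
Implicit Types v w : 'cV[C]_n.

Definition vnorm v : R := Num.sqrt (\sum_i normc (v i 0) ^+ 2).

Lemma sum_sqr_ge0 v : 0 <= \sum_i normc (v i 0) ^+ 2.
Proof. by apply: sumr_ge0 => i _; rewrite sqr_ge0. Qed.

Lemma vnorm_ge0 v : 0 <= vnorm v. Proof. exact: sqrtr_ge0. Qed.

Lemma vnorm_sqr v : vnorm v ^+ 2 = \sum_i normc (v i 0) ^+ 2.
Proof. by rewrite sqr_sqrtr ?sum_sqr_ge0. Qed.

Lemma normc_le_vnorm v i : normc (v i 0) <= vnorm v.
Proof.
rewrite -(ger0_norm (normc_ge0 _)) -sqrtr_sqr ler_wsqrtr // (bigD1 i) //=.
by rewrite lerDl sumr_ge0 // => j _; rewrite sqr_ge0.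
Qed.

Lemma vnorm_eq0 v : vnorm v = 0 -> v = 0.
Proof.
move=> v0; apply/colP => i; rewrite mxE; apply: eq0_normc.
by apply/le_anti; rewrite normc_ge0 andbT -v0 normc_le_vnorm.
Qed.

Lemma vnorm0 : vnorm 0 = 0.
Proof. by rewrite /vnorm big1 ?sqrtr0 // => i _; rewrite mxE normc0 expr0n. Qed.

Lemma vnormZ c v : vnorm (c *: v) = normc c * vnorm v.
Proof.
rewrite /vnorm; under eq_bigr do rewrite mxE normcM exprMn.
by rewrite -mulr_sumr sqrtrM ?sqr_ge0 // sqrtr_sqr ger0_norm ?normc_ge0.
Qed.

Lemma vnormD v w : vnorm (v + w) <= vnorm v + vnorm w.
Proof.
rewrite -(ler_pXn2r (ltn0Sn 1)) ?nnegrE ?addr_ge0 ?vnorm_ge0 //.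
rewrite sqrrD !vnorm_sqr.
apply: (@le_trans _ _ (\sum_i (normc (v i 0) + normc (w i 0)) ^+ 2)).
  apply: ler_sum => i _.
  by rewrite ler_pXn2r ?nnegrE ?addr_ge0 ?normc_ge0 // mxE le_normcD.
under eq_bigr do rewrite sqrrD.
rewrite !big_split /= lerD2r lerD2l.
rewrite mulr2n; apply: lerD; exact: cauchy_schwarz.
Qed.

Lemma vnorm_le_sum v : vnorm v <= \sum_i normc (v i 0).
Proof.
have s0 : 0 <= \sum_i normc (v i 0) by apply: sumr_ge0 => i _; exact: normc_ge0.
rewrite -(ler_pXn2r (ltn0Sn 1)) ?nnegrE ?vnorm_ge0 // vnorm_sqr expr2 mulr_suml.
apply: ler_sum => i _; rewrite expr2 ler_wpM2l ?normc_ge0 // (bigD1 i) //=.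
by rewrite lerDl sumr_ge0 // => j _; exact: normc_ge0.
Qed.

End Vectors.

(** * The operator norm and the C*-identity *)

Section Operators.
Variable n : nat.
Implicit Types (a b : 'M[C]_n) (v : 'cV[C]_n).

Definition mstar a : 'M[C]_n := map_mx Num.conj a^T.

(** A crude bound for the operator norm: it makes the supremum in [opnorm] finite and turns
    entrywise convergence into convergence in norm. *)
Definition entry_sum a : R := \sum_i \sum_j normc (a i j).

Lemma vnorm_mul_entry_sum a v : vnorm (a *m v) <= entry_sum a * vnorm v.
Proof.
apply: le_trans (vnorm_le_sum _) _; rewrite mulr_suml; apply: ler_sum => i _.
rewrite mxE mulr_suml; apply: le_trans (normc_sum _) _; apply: ler_sum => j _.
by rewrite normcM ler_wpM2l ?normc_ge0 ?normc_le_vnorm.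
Qed.

Local Open Scope classical_set_scope.

Definition opnorm a : R := sup [set vnorm (a *m v) | v in [set v | vnorm v <= 1]].

Lemma entry_sum_ge0 a : 0 <= entry_sum a.
Proof. by do 2![apply: sumr_ge0 => ? _]; exact: normc_ge0. Qed.

Lemma opnorm_has_sup a : has_sup [set vnorm (a *m v) | v in [set v | vnorm v <= 1]].
Proof.
split; first by exists (vnorm (a *m 0)), 0 => //=; rewrite vnorm0 ler01.
exists (entry_sum a) => _ [v /= v1 <-].
apply: le_trans (vnorm_mul_entry_sum _ _) _.
by rewrite -[leRHS]mulr1 ler_wpM2l ?entry_sum_ge0.
Qed.

Lemma opnorm_ub a v : vnorm v <= 1 -> vnorm (a *m v) <= opnorm a.
Proof. by move=> v1; apply: (sup_upper_bound (opnorm_has_sup a)); exists v. Qed.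

Lemma opnorm_le a M : (forall v, vnorm v <= 1 -> vnorm (a *m v) <= M) -> opnorm a <= M.
Proof.
by move=> h; apply: ge_sup => [|_ [v v1 <-]]; [case: (opnorm_has_sup a)|exact: h].
Qed.

Lemma opnorm_ge0 a : 0 <= opnorm a.
Proof. by apply: le_trans (opnorm_ub a (v := 0) _); rewrite ?vnorm_ge0 ?vnorm0 ?ler01. Qed.

Lemma vnorm_mul a v : vnorm (a *m v) <= opnorm a * vnorm v.
Proof.
have [/vnorm_eq0 ->|v0] := eqVneq (vnorm v) 0; first by rewrite mulmx0 vnorm0 mulr0.
have v_gt0 : 0 < vnorm v by rewrite lt_neqAle eq_sym v0 vnorm_ge0.
have nV : normc (vnorm v)^-1%:C = (vnorm v)^-1.
  by rewrite /normc /= expr0n addr0 sqrtr_sqr ger0_norm ?invr_ge0 ?vnorm_ge0.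
have := @opnorm_ub a ((vnorm v)^-1%:C *: v).
rewrite vnormZ nV mulVf // lexx -scalemxAr vnormZ nV => /(_ isT).
by rewrite ler_pdivrMl // mulrC.
Qed.

Lemma opnormD a b : opnorm (a + b) <= opnorm a + opnorm b.
Proof.
apply: opnorm_le => v v1; rewrite mulmxDl; apply: le_trans (vnormD _ _) _.
by apply: lerD; exact: opnorm_ub.
Qed.

Lemma opnormM a b : opnorm (a *m b) <= opnorm a * opnorm b.
Proof.
apply: opnorm_le => v v1; rewrite -mulmxA; apply: le_trans (vnorm_mul _ _) _.
by apply: ler_wpM2l; [exact: opnorm_ge0|exact: opnorm_ub].
Qed.

Lemma opnormZ c a : opnorm (c *: a) = normc c * opnorm a.
Proof.
have le c' a' : opnorm (c' *: a') <= normc c' * opnorm a'.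
  apply: opnorm_le => v v1; rewrite -scalemxAl vnormZ.
  by rewrite ler_wpM2l ?normc_ge0 ?opnorm_ub.
apply/le_anti; rewrite le /=.
have [->|c0] := eqVneq c 0; first by rewrite normc0 mul0r opnorm_ge0.
have nc0 : 0 < normc c.
  rewrite lt_neqAle normc_ge0 andbT eq_sym; apply: contra c0 => /eqP/eq0_normc.
  by move->.
by rewrite -ler_pdivlMl // -normcV -{1}[a](scalerK c0) le.
Qed.

Lemma normc_le_opnorm a i j : normc (a i j) <= opnorm a.
Proof.
have d1 : vnorm (delta_mx j 0 : 'cV[C]_n) <= 1.
  apply: le_trans (vnorm_le_sum _) _; rewrite (bigD1 j) //= big1 => [|k /negPf kj].
    by rewrite mxE !eqxx mulr1n normc1 addr0.
  by rewrite mxE kj mulr0n normc0.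
apply: le_trans (opnorm_ub a d1); apply: le_trans (normc_le_vnorm _ i).
by rewrite -colE mxE.
Qed.

Lemma opnorm_le_entry_sum a : opnorm a <= entry_sum a.
Proof.
apply: opnorm_le => v v1; apply: le_trans (vnorm_mul_entry_sum _ _) _.
by rewrite -[leRHS]mulr1 ler_wpM2l ?entry_sum_ge0.
Qed.

Lemma opnorm_eq0 a : opnorm a = 0 -> a = 0.
Proof.
move=> a0; apply/matrixP => i j; rewrite mxE; apply: eq0_normc.
by apply/le_anti; rewrite normc_ge0 andbT -a0 normc_le_opnorm.
Qed.

Lemma mstarM a b : mstar (a *m b) = mstar b *m mstar a.
Proof. by rewrite /mstar trmx_mul map_mxM. Qed.

Lemma mstarK a : mstar (mstar a) = a.
Proof. by apply/matrixP => i j; rewrite !mxE conjCK. Qed.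

Lemma mstarD a b : mstar (a + b) = mstar a + mstar b.
Proof. by apply/matrixP => i j; rewrite !mxE rmorphD. Qed.

Lemma mstarZ c a : mstar (c *: a) = Num.conj c *: mstar a.
Proof. by apply/matrixP => i j; rewrite !mxE rmorphM. Qed.

(** Cauchy-Schwarz applied to |av|^2 = <v, a^* a v>. *)
Lemma vnorm_sqr_le a v : vnorm (a *m v) ^+ 2 <= vnorm v * vnorm (mstar a *m a *m v).
Proof.
have vnorm_form m (w : 'cV[C]_m) :
    (vnorm w ^+ 2)%:C = \sum_i Num.conj (w i 0) * w i 0.
  by rewrite vnorm_sqr rmorph_sum /=; apply: eq_bigr => i _; exact: normc_sqr.
have e : (vnorm (a *m v) ^+ 2)%:C =
    \sum_i Num.conj (v i 0) * (mstar a *m a *m v) i 0.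
  rewrite vnorm_form -mulmxA.
  under [RHS]eq_bigr do rewrite mxE mulr_sumr.
  rewrite exchange_big; apply: eq_bigr => j _ /=.
  rewrite {1}mxE rmorph_sum mulr_suml; apply: eq_bigr => i _.
  by rewrite rmorphM !mxE /= mulrA [_ * Num.conj (a _ _)]mulrC.
have -> : vnorm (a *m v) ^+ 2 = normc ((vnorm (a *m v) ^+ 2)%:C).
  by rewrite /normc /= expr0n addr0 sqrtr_sqr ger0_norm ?sqr_ge0.
rewrite e; apply: le_trans (normc_sum _) _.
under eq_bigr do rewrite normcM normc_conj.
exact: cauchy_schwarz.
Qed.

(** From [vnorm_sqr_le], |b|^2 <= |b^* b| <= |b^*| |b|, hence |b| <= |b^*|; applied to the adjoint
    as well, this closes the chain. *)
Lemma opnorm_star_mul a : opnorm (mstar a *m a) = opnorm a ^+ 2.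
Proof.
have sq_le b : opnorm b ^+ 2 <= opnorm (mstar b *m b).
  rewrite -(sqr_sqrtr (opnorm_ge0 (mstar b *m b))).
  rewrite ler_pXn2r ?nnegrE ?sqrtr_ge0 ?opnorm_ge0 //.
  apply: opnorm_le => v v1.
  rewrite -(ler_pXn2r (ltn0Sn 1)) ?nnegrE ?vnorm_ge0 ?sqrtr_ge0 //.
  rewrite (sqr_sqrtr (opnorm_ge0 _)); apply: le_trans (vnorm_sqr_le _ _) _.
  apply: le_trans (opnorm_ub _ v1).
  by rewrite -[leRHS]mul1r ler_wpM2r ?vnorm_ge0.
have le_star b : opnorm b <= opnorm (mstar b).
  have [->|b0] := eqVneq (opnorm b) 0; first exact: opnorm_ge0.
  have b_gt0 : 0 < opnorm b by rewrite lt_neqAle eq_sym b0 opnorm_ge0.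
  rewrite -(ler_pM2r b_gt0) -expr2; exact: le_trans (sq_le b) (opnormM _ _).
apply/le_anti; rewrite sq_le andbT expr2; apply: le_trans (opnormM _ _) _.
by rewrite ler_wpM2r ?opnorm_ge0 // -{2}(mstarK a).
Qed.

End Operators.
End MatrixCstar.

(** * Completeness of the matrix algebra *)

Section MatrixCstarComplete.
Import boolp.
Local Open Scope ring_scope.
Import ComplexField.Normc.

Lemma real_complete (u : nat -> RR) :
  (forall e : RR, 0 < e -> exists N, forall m n, (N <= m)%N -> (N <= n)%N ->
     `|u m - u n| < e) ->
  exists l : RR, forall e : RR, 0 < e -> exists N, forall n, (N <= n)%N -> `|u n - l| < e.
Proof.
move=> cu; case: (Rcomplete.R_complete u) => [e /RltP e0|l ul].
  have [N hN] := cu e e0; exists N => m n /ssrnat.leP Nm /ssrnat.leP Nn.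
  by apply/RltP; rewrite RdistE; apply: hN.
exists l => e /RltP e0; have [N hN] := ul e e0; exists N => n /ssrnat.leP Nn.
by have /RltP := hN n Nn; rewrite RdistE.
Qed.

(** The operator norm dominates the real and imaginary parts of each entry, so these are Cauchy;
    their limits are assembled into a matrix. *)
Lemma matrix_complete n (u : nat -> 'M[CC]_n) :
  (forall e : RR, 0 < e -> exists N : nat, forall m k : nat,
        (N <= m)%N -> (N <= k)%N -> opnorm (u m - u k : 'M[RR[i]]_n) < e) ->
  exists l : 'M[CC]_n, forall e : RR, 0 < e -> exists N : nat, forall k : nat,
        (N <= k)%N -> opnorm (u k - l : 'M[RR[i]]_n) < e.
Proof.
move=> cu.
have part (f : RR[i] -> RR) :
    (forall x y : RR[i], f (x - y) = f x - f y) ->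
    (forall x : RR[i], `|f x| <= normc x) ->
    forall i j, exists l : RR, forall e : RR, 0 < e -> exists N, forall k, (N <= k)%N ->
      `|f (u k i j : RR[i]) - l| < e.
  move=> fB fn i j; apply: real_complete => e /cu [N hN]; exists N => m k Nm Nk.
  apply: le_lt_trans (hN m k Nm Nk); rewrite -fB; apply: le_trans (fn _) _.
  by have := normc_le_opnorm (u m - u k : 'M[RR[i]]_n) i j; rewrite !mxE.
have sq_le (x y : RR) : `|x| <= Num.sqrt (x ^+ 2 + y ^+ 2).
  by rewrite -sqrtr_sqr ler_wsqrtr // lerDl sqr_ge0.
have le_abs (x y : RR) : Num.sqrt (x ^+ 2 + y ^+ 2) <= `|x| + `|y|.
  rewrite -(ler_pXn2r (ltn0Sn 1)) ?nnegrE ?sqrtr_ge0 ?addr_ge0 //.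
  rewrite sqr_sqrtr ?addr_ge0 ?sqr_ge0 // sqrrD !real_normK ?num_real //.
  by rewrite lerD2r lerDl mulrn_wge0 // mulr_ge0.
have reB (x y : RR[i]) : complex.Re (x - y) = complex.Re x - complex.Re y.
  by case: x y => ? ? [].
have imB (x y : RR[i]) : complex.Im (x - y) = complex.Im x - complex.Im y.
  by case: x y => ? ? [].
have re_le (x : RR[i]) : `|complex.Re x| <= normc x by case: x => ? ?; exact: sq_le.
have im_le (x : RR[i]) : `|complex.Im x| <= normc x.
  by case: x => ? ?; rewrite /= addrC; exact: sq_le.
have [re hre] := choice (fun ij : 'I_n * 'I_n => part _ reB re_le ij.1 ij.2).
have [im him] := choice (fun ij : 'I_n * 'I_n => part _ imB im_le ij.1 ij.2).
exists (\matrix_(i, j) (re (i, j) +i* im (i, j))%C) => e e0.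
(* There are n^2 entries, each contributing at most 2e/M, so M has to exceed 2n^2. *)
pose M : RR := (n * n * 2).+1%:R; have M0 : 0 < M by rewrite ltr0Sn.
have eM : 0 < e / M by rewrite divr_gt0.
have near ij : exists N, forall k, (N <= k)%N ->
    `|complex.Re (u k ij.1 ij.2 : RR[i]) - re ij| < e / M /\
    `|complex.Im (u k ij.1 ij.2 : RR[i]) - im ij| < e / M.
  have [N1 h1] := hre ij _ eM; have [N2 h2] := him ij _ eM.
  exists (maxn N1 N2) => k; rewrite geq_max => /andP[k1 k2].
  by split; [exact: h1|exact: h2].
have [N hN] := choice near.
exists (\max_ij N ij)%N => k hk.
apply: le_lt_trans (opnorm_le_entry_sum _) _.
apply: (@le_lt_trans _ _ (\sum_(i < n) \sum_(j < n) (e / M) *+ 2)).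
  apply: ler_sum => i _; apply: ler_sum => j _.
  have [/ltW h1 /ltW h2] := hN (i, j) k (leq_trans (leq_bigmax (i, j)) hk).
  rewrite !mxE mulr2n; move: h1 h2 => /=; case: (u k i j : RR[i]) => x y /= h1 h2.
  exact: le_trans (le_abs _ _) (lerD h1 h2).
rewrite !sumr_const !card_ord -!mulrnA mulnC -mulnA -mulr_natl mulrCA.
rewrite gtr_pMr // ltr_pdivrMr // mul1r ltr_nat.
by rewrite ltnS mulnA.
Qed.

(** The size is [n.+1], so that 1 differs from 0; [matrix_cstar 7] is M_8(C). It ends with [Defined]
    so that its operations unfold to those of matrices. *)
Definition matrix_cstar (n : nat) : cstar_algebra.
Proof.
refine (@CStarAlgebra ('M[CC]_n.+1 : algType CC) (@mstar _ _) (@opnorm _ _)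
  _ _ _ _ _ _ _ _ _ _ _).
- exact: mstarD.
- exact: mstarZ.
- exact: mstarM.
- exact: mstarK.
- exact: opnorm_ge0.
- exact: opnorm_eq0.
- exact: opnormD.
- exact: opnormZ.
- exact: opnormM.
- exact: opnorm_star_mul.
- exact: matrix_complete.
Defined.

End MatrixCstarComplete.

(** * The model: fifteen blocks of eight vertices *)

(* One root for each line, eight per block, with coordinates shifted by one as in
   [e8vec]. The Pauli matrices act on R^8 with basis indexed by F_2^3, X_a by translations
   and Z_b by the signs of characters. Block d - 1, for 0 < d < 8, is the joint eigenbasis
   of X_d and the Z_b with b orthogonal to d; the last eight blocks consist of the sign
   vectors (-1)^f with f a quadratic form on F_2^3, one block for each polar form of f.
   Within a block the binary digits of the index are the eigenvalue signs on a basis of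
   the 3-space of the block. *)
Definition root_table : seq (seq nat) :=
 [:: [:: 2; 2; 1; 1; 1; 1; 1; 1]; [:: 2; 0; 1; 1; 1; 1; 1; 1];
     [:: 1; 1; 2; 2; 1; 1; 1; 1]; [:: 1; 1; 2; 0; 1; 1; 1; 1];
     [:: 1; 1; 1; 1; 2; 2; 1; 1]; [:: 1; 1; 1; 1; 2; 0; 1; 1];
     [:: 1; 1; 1; 1; 1; 1; 2; 2]; [:: 1; 1; 1; 1; 1; 1; 2; 0];
     [:: 2; 1; 2; 1; 1; 1; 1; 1]; [:: 2; 1; 0; 1; 1; 1; 1; 1];
     [:: 1; 2; 1; 2; 1; 1; 1; 1]; [:: 1; 2; 1; 0; 1; 1; 1; 1];
     [:: 1; 1; 1; 1; 2; 1; 2; 1]; [:: 1; 1; 1; 1; 2; 1; 0; 1];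
     [:: 1; 1; 1; 1; 1; 2; 1; 2]; [:: 1; 1; 1; 1; 1; 2; 1; 0];
     [:: 2; 1; 1; 2; 1; 1; 1; 1]; [:: 2; 1; 1; 0; 1; 1; 1; 1];
     [:: 1; 2; 2; 1; 1; 1; 1; 1]; [:: 1; 2; 0; 1; 1; 1; 1; 1];
     [:: 1; 1; 1; 1; 2; 1; 1; 2]; [:: 1; 1; 1; 1; 2; 1; 1; 0];
     [:: 1; 1; 1; 1; 1; 2; 2; 1]; [:: 1; 1; 1; 1; 1; 2; 0; 1];
     [:: 2; 1; 1; 1; 2; 1; 1; 1]; [:: 2; 1; 1; 1; 0; 1; 1; 1];
     [:: 1; 2; 1; 1; 1; 2; 1; 1]; [:: 1; 2; 1; 1; 1; 0; 1; 1];
     [:: 1; 1; 2; 1; 1; 1; 2; 1]; [:: 1; 1; 2; 1; 1; 1; 0; 1];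
     [:: 1; 1; 1; 2; 1; 1; 1; 2]; [:: 1; 1; 1; 2; 1; 1; 1; 0];
     [:: 2; 1; 1; 1; 1; 2; 1; 1]; [:: 2; 1; 1; 1; 1; 0; 1; 1];
     [:: 1; 1; 2; 1; 1; 1; 1; 2]; [:: 1; 1; 2; 1; 1; 1; 1; 0];
     [:: 1; 2; 1; 1; 2; 1; 1; 1]; [:: 1; 2; 1; 1; 0; 1; 1; 1];
     [:: 1; 1; 1; 2; 1; 1; 2; 1]; [:: 1; 1; 1; 2; 1; 1; 0; 1];
     [:: 2; 1; 1; 1; 1; 1; 2; 1]; [:: 2; 1; 1; 1; 1; 1; 0; 1];
     [:: 1; 2; 1; 1; 1; 1; 1; 2]; [:: 1; 2; 1; 1; 1; 1; 1; 0];
     [:: 1; 1; 2; 1; 2; 1; 1; 1]; [:: 1; 1; 2; 1; 0; 1; 1; 1];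
     [:: 1; 1; 1; 2; 1; 2; 1; 1]; [:: 1; 1; 1; 2; 1; 0; 1; 1];
     [:: 2; 1; 1; 1; 1; 1; 1; 2]; [:: 2; 1; 1; 1; 1; 1; 1; 0];
     [:: 1; 1; 2; 1; 1; 2; 1; 1]; [:: 1; 1; 2; 1; 1; 0; 1; 1];
     [:: 1; 1; 1; 2; 2; 1; 1; 1]; [:: 1; 1; 1; 2; 0; 1; 1; 1];
     [:: 1; 2; 1; 1; 1; 1; 2; 1]; [:: 1; 2; 1; 1; 1; 1; 0; 1];
     [:: 2; 2; 2; 2; 2; 2; 2; 2]; [:: 2; 0; 2; 0; 2; 0; 2; 0];
     [:: 2; 2; 0; 0; 2; 2; 0; 0]; [:: 2; 0; 0; 2; 2; 0; 0; 2];
     [:: 2; 2; 2; 2; 0; 0; 0; 0]; [:: 2; 0; 2; 0; 0; 2; 0; 2];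
     [:: 2; 2; 0; 0; 0; 0; 2; 2]; [:: 2; 0; 0; 2; 0; 2; 2; 0];
     [:: 2; 2; 2; 2; 2; 2; 0; 0]; [:: 2; 0; 2; 0; 2; 0; 0; 2];
     [:: 2; 2; 2; 2; 0; 0; 2; 2]; [:: 2; 0; 2; 0; 0; 2; 2; 0];
     [:: 2; 2; 0; 0; 2; 2; 2; 2]; [:: 2; 0; 0; 2; 2; 0; 2; 0];
     [:: 2; 2; 0; 0; 0; 0; 0; 0]; [:: 2; 0; 0; 2; 0; 2; 0; 2];
     [:: 2; 2; 2; 2; 2; 0; 2; 0]; [:: 2; 2; 0; 0; 2; 0; 0; 2];
     [:: 2; 2; 2; 2; 0; 2; 0; 2]; [:: 2; 2; 0; 0; 0; 2; 2; 0];
     [:: 2; 0; 2; 0; 2; 2; 2; 2]; [:: 2; 0; 0; 2; 2; 2; 0; 0];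
     [:: 2; 0; 2; 0; 0; 0; 0; 0]; [:: 2; 0; 0; 2; 0; 0; 2; 2];
     [:: 2; 2; 2; 2; 2; 0; 0; 2]; [:: 2; 2; 0; 0; 2; 0; 2; 0];
     [:: 2; 2; 2; 2; 0; 2; 2; 0]; [:: 2; 2; 0; 0; 0; 2; 0; 2];
     [:: 2; 0; 0; 2; 2; 2; 2; 2]; [:: 2; 0; 2; 0; 2; 2; 0; 0];
     [:: 2; 0; 0; 2; 0; 0; 0; 0]; [:: 2; 0; 2; 0; 0; 0; 2; 2];
     [:: 2; 2; 2; 0; 2; 2; 2; 0]; [:: 2; 2; 2; 0; 0; 0; 0; 2];
     [:: 2; 2; 0; 2; 2; 2; 0; 2]; [:: 2; 2; 0; 2; 0; 0; 2; 0];
     [:: 2; 0; 2; 2; 2; 0; 2; 2]; [:: 2; 0; 2; 2; 0; 2; 0; 0];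
     [:: 2; 0; 0; 0; 2; 0; 0; 0]; [:: 2; 0; 0; 0; 0; 2; 2; 2];
     [:: 2; 2; 2; 0; 2; 2; 0; 2]; [:: 2; 2; 2; 0; 0; 0; 2; 0];
     [:: 2; 0; 2; 2; 0; 2; 2; 2]; [:: 2; 0; 2; 2; 2; 0; 0; 0];
     [:: 2; 2; 0; 2; 2; 2; 2; 0]; [:: 2; 2; 0; 2; 0; 0; 0; 2];
     [:: 2; 0; 0; 0; 0; 2; 0; 0]; [:: 2; 0; 0; 0; 2; 0; 2; 2];
     [:: 2; 2; 2; 0; 2; 0; 2; 2]; [:: 2; 2; 2; 0; 0; 2; 0; 0];
     [:: 2; 2; 0; 2; 0; 2; 2; 2]; [:: 2; 2; 0; 2; 2; 0; 0; 0];
     [:: 2; 0; 2; 2; 2; 2; 2; 0]; [:: 2; 0; 2; 2; 0; 0; 0; 2];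
     [:: 2; 0; 0; 0; 0; 0; 2; 0]; [:: 2; 0; 0; 0; 2; 2; 0; 2];
     [:: 2; 0; 2; 2; 2; 2; 0; 2]; [:: 2; 0; 2; 2; 0; 0; 2; 0];
     [:: 2; 2; 2; 0; 0; 2; 2; 2]; [:: 2; 2; 2; 0; 2; 0; 0; 0];
     [:: 2; 2; 0; 2; 2; 0; 2; 2]; [:: 2; 2; 0; 2; 0; 2; 0; 0];
     [:: 2; 0; 0; 0; 0; 0; 0; 2]; [:: 2; 0; 0; 0; 2; 2; 2; 0]].

(* The entry at p, q gives the coordinates, as binary digits, of the common nonzero vector
   of the spaces of blocks p and q in the chosen basis of the former (0 if p = q). *)
Definition line_table : seq (seq nat) :=
 [:: [:: 0; 4; 4; 2; 2; 6; 6; 1; 1; 5; 5; 3; 3; 7; 7];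
     [:: 4; 0; 4; 2; 6; 2; 6; 1; 5; 1; 5; 3; 7; 3; 7];
     [:: 4; 4; 0; 2; 6; 6; 2; 1; 5; 5; 1; 3; 7; 7; 3];
     [:: 4; 2; 6; 0; 4; 2; 6; 1; 5; 3; 7; 1; 5; 3; 7];
     [:: 2; 4; 6; 2; 0; 6; 4; 1; 3; 5; 7; 3; 1; 7; 5];
     [:: 4; 2; 6; 2; 6; 0; 4; 1; 5; 3; 7; 3; 7; 1; 5];
     [:: 6; 4; 2; 2; 4; 6; 0; 1; 7; 5; 3; 3; 5; 7; 1];
     [:: 1; 2; 3; 4; 5; 6; 7; 0; 1; 2; 3; 4; 5; 6; 7];
     [:: 1; 4; 5; 2; 3; 6; 7; 1; 0; 5; 4; 3; 2; 7; 6];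
     [:: 4; 1; 5; 2; 6; 3; 7; 1; 5; 0; 4; 3; 7; 2; 6];
     [:: 4; 5; 1; 2; 6; 7; 3; 1; 5; 4; 0; 3; 7; 6; 2];
     [:: 4; 2; 6; 1; 5; 3; 7; 1; 5; 3; 7; 0; 4; 2; 6];
     [:: 2; 4; 6; 3; 1; 7; 5; 1; 3; 5; 7; 2; 0; 6; 4];
     [:: 4; 2; 6; 3; 7; 1; 5; 1; 5; 3; 7; 2; 6; 0; 4];
     [:: 6; 4; 2; 3; 5; 7; 1; 1; 7; 5; 3; 2; 4; 6; 0]].

(* Sign corrections that turn the adjacency of the complement of Gamma_1 into the one
   of the lines of E8. *)
Definition sign_table : seq (seq nat) :=
 [:: [:: 0; 0; 0; 0; 0; 0; 0; 0; 0; 0; 0; 0; 0; 0; 1];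
     [:: 0; 0; 0; 0; 0; 0; 0; 0; 0; 0; 0; 0; 0; 0; 0];
     [:: 0; 0; 0; 0; 0; 0; 0; 0; 0; 0; 0; 1; 1; 1; 0];
     [:: 0; 0; 0; 0; 0; 0; 0; 0; 0; 0; 0; 0; 0; 0; 0];
     [:: 0; 0; 0; 0; 0; 0; 0; 0; 0; 1; 1; 0; 0; 1; 0];
     [:: 0; 0; 0; 0; 0; 0; 0; 0; 1; 0; 1; 0; 1; 0; 1];
     [:: 0; 0; 0; 0; 0; 0; 0; 0; 1; 1; 0; 1; 0; 0; 0];
     [:: 0; 0; 0; 0; 0; 0; 0; 0; 0; 0; 0; 0; 0; 0; 0];
     [:: 0; 0; 0; 0; 0; 1; 1; 0; 0; 0; 0; 0; 0; 1; 0];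
     [:: 0; 0; 0; 0; 1; 0; 1; 0; 0; 0; 0; 0; 1; 0; 1];
     [:: 0; 0; 0; 0; 1; 1; 0; 0; 0; 0; 0; 1; 0; 0; 0];
     [:: 0; 0; 1; 0; 0; 0; 1; 0; 0; 0; 1; 0; 0; 0; 1];
     [:: 0; 0; 1; 0; 0; 1; 0; 0; 0; 1; 0; 0; 0; 0; 0];
     [:: 0; 0; 1; 0; 1; 0; 0; 0; 1; 0; 0; 0; 0; 0; 1];
     [:: 1; 0; 0; 0; 0; 1; 0; 0; 0; 1; 0; 1; 0; 1; 0]].

Definition bit (k n : nat) : bool := odd (iter k half n).

(** Four digits serve both the indices below 8 and the block numbers up to 15. *)
Definition xor4 (i j : nat) : nat :=
  foldr (fun k n => (bit k i (+) bit k j) + n.*2) 0 (iota 0 4).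

(** The value, as an exponent of -1, of the character i at the vector with coordinate digits m. *)
Definition dot3 (m i : nat) : bool :=
  (odd m && odd i) (+) (odd m./2 && odd i./2) (+) (odd m./2./2 && odd i./2./2).

Definition line (p q : nat) : nat := nth 0 (nth [::] line_table p) q.

Definition e8_sign (p q : nat) : bool := nth 0 (nth [::] sign_table p) q == 1.

Definition no_sign (p q : nat) : bool := false.

(** Cosets of one space are disjoint and lines of one frame are orthogonal, so a block is a clique.
    Across blocks the parameter [c] selects the graph: [no_sign] gives the complement of Gamma_1,
    [e8_sign] the lines of E8. *)
Definition madj (c : nat -> nat -> bool) (v w : nat * nat) : bool :=
  if v.1 == w.1 then v.2 != w.2
  else dot3 (line v.1 w.1) v.2 (+) dot3 (line w.1 v.1) w.2 (+) c v.1 w.1.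

(** Pairs of natural numbers instead of elements of [V], so that the checks reduce by
    computation. *)
Definition mverts : seq (nat * nat) := [seq (p, i) | p <- iota 0 15, i <- iota 0 8].

Definition V : finType := ('I_15 * 'I_8)%type.

Definition nv (v : V) : nat * nat := (v.1 : nat, v.2 : nat).

Definition medge c : rel V := fun v w => madj c (nv v) (nv w).

Lemma nv_inj : injective nv.
Proof. by move=> [p i] [q j] [/val_inj -> /val_inj ->]. Qed.

Lemma mem_mverts (x : nat * nat) : (x \in mverts) = (x.1 < 15) && (x.2 < 8).
Proof.
case: x => p i; apply/allpairsP/andP => [[[q j] [+ + [-> ->]]]|[hp hi]].
  by rewrite !mem_iota.
by exists (p, i); split; rewrite ?mem_iota.
Qed.

Lemma nv_mverts v : nv v \in mverts.
Proof. by rewrite mem_mverts !ltn_ord. Qed.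

Lemma mvertsP x : x \in mverts -> exists v, x = nv v.
Proof.
by rewrite mem_mverts; case: x => p i /andP[/= hp hi]; exists (Ordinal hp, Ordinal hi).
Qed.

Lemma card_nv (P : pred (nat * nat)) : #|[set v | P (nv v)]| = count P mverts.
Proof.
have /seq.permP <- : perm_eq [seq nv v | v <- enum V] mverts.
  apply: uniq_perm => [||x]; rewrite ?(map_inj_uniq nv_inj) ?enum_uniq //.
  apply/mapP/idP => [[v _ ->]|/mvertsP[v ->]]; first exact: nv_mverts.
  by exists v; rewrite ?mem_enum.
by rewrite count_map enumT cardsE cardE /enum_mem size_filter.
Qed.

(** * Strong regularity of both models *)

Definition mrow c v : seq bool := [seq madj c v z | z <- mverts].

Definition mrows c : seq (nat * nat * seq bool) := [seq (v, mrow c v) | v <- mverts].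

Definition count2 (r s : seq bool) : nat := count (fun b => b.1 && b.2) (zip r s).

Definition srg_check c (R : seq (nat * nat * seq bool)) : bool :=
  all (fun r => (count id r.2 == 63) && all (fun s => (r.1 == s.1) ||
     (count2 r.2 s.2 == if madj c r.1 s.1 then 30 else 36)) R) R.

Lemma srg_checkP c : srg_check c (mrows c) -> srg_with (medge c) 120 63 30 36.
Proof.
move=> /allP chk; have mem v : (nv v, mrow c (nv v)) \in mrows c.
  by apply/mapP; exists (nv v) => //; exact: nv_mverts.
have deg v : #|[set y | medge c v y]| = 63.
  have /andP[/eqP <- _] := chk _ (mem v).
  by rewrite (card_nv (madj c (nv v))) count_map.
have com v w : v != w ->
    #|[set z | medge c v z && medge c w z]| = if medge c v w then 30 else 36.
  move=> /negPf vw; have /andP[_ /allP/(_ _ (mem w))] := chk _ (mem v).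
  rewrite (inj_eq nv_inj) vw /= => /eqP <-.
  rewrite (card_nv (fun z => madj c (nv v) z && madj c (nv w) z)).
  by rewrite /count2 zip_map count_map.
split=> [|//|v w vw e|v w vw /negPf e]; first by rewrite card_prod !card_ord.
- by rewrite com // e.
- by rewrite com // e.
Qed.

Lemma srg_e8_model : srg_with (medge e8_sign) 120 63 30 36.
Proof. apply: srg_checkP. reflexivity. Qed.

Lemma srg_gamma_model : srg_with (medge no_sign) 120 63 30 36.
Proof. apply: srg_checkP. reflexivity. Qed.

(** * A graph invariant that separates the models *)

Definition third_vertex (T : finType) (e : rel T) (x y : T) : Prop :=
  exists z, [/\ z != x, z != y & forall u, e x u -> e y u -> e z u].

Definition subrow (r s t : seq bool) : bool :=
  all (fun b => b.1 && b.2.1 ==> b.2.2) (zip r (zip s t)).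

Definition third_check (R : seq (nat * nat * seq bool)) (r s : nat * nat * seq bool) :=
  has (fun t => [&& t.1 != r.1, t.1 != s.1 & subrow r.2 s.2 t.2]) R.

(* The third line in the span of two non-orthogonal roots lies in the block whose
   (1-based) number is the xor of the numbers of their blocks. *)
Definition all_third_check c (R : seq (nat * nat * seq bool)) : bool :=
  all (fun r => all (fun s => (r.1.1 == s.1.1) || madj c r.1 s.1 ||
    third_check (take 8 (drop ((xor4 r.1.1.+1 s.1.1.+1).-1 * 8) R)) r s) R) R.

Lemma third_checkP c v w :
  reflect (third_vertex (medge c) v w)
    (third_check (mrows c) (nv v, mrow c (nv v)) (nv w, mrow c (nv w))).
Proof.
have subP z : reflect (forall u, medge c v u -> medge c w u -> medge c z u)
    (subrow (mrow c (nv v)) (mrow c (nv w)) (mrow c (nv z))).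
  rewrite /subrow !zip_map all_map; apply: (iffP allP) => [h u vu wu|h _ /mvertsP[u ->]].
    by have /= /implyP := h _ (nv_mverts u); apply; apply/andP.
  by apply/implyP => /= /andP[]; exact: h.
apply: (iffP hasP) => [[_ /mapP[_ /mvertsP[z ->] ->] /and3P[/= zv zw /subP h]]|].
  by exists z; split=> //; rewrite -(inj_eq nv_inj).
move=> [z [zv zw /subP h]]; exists (nv z, mrow c (nv z)).
  by apply/mapP; exists (nv z) => //; exact: nv_mverts.
by rewrite /= !(inj_eq nv_inj) zv zw.
Qed.

Lemma all_third_checkP c : all_third_check c (mrows c) ->
  forall v w, v != w -> ~~ medge c v w -> third_vertex (medge c) v w.
Proof.
move=> /allP chk v w vw nvw; apply/third_checkP.
have mem u : (nv u, mrow c (nv u)) \in mrows c.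
  by apply/mapP; exists (nv u) => //; exact: nv_mverts.
have /allP/(_ _ (mem w)) /orP[/orP[/eqP e|e]|/hasP[t tR ht]] := chk _ (mem v).
(* Distinct vertices of one block are adjacent. *)
- case/negP: nvw; rewrite /medge /madj [(nv v).1]e eqxx.
  by apply: contra vw => /eqP e2; apply/eqP/nv_inj/pair_equal_spec.
- by case/negP: nvw.
- by apply/hasP; exists t => //; apply: mem_drop (mem_take tR).
Qed.

Lemma e8_model_third v w : v != w -> ~~ medge e8_sign v w ->
  third_vertex (medge e8_sign) v w.
Proof. apply: all_third_checkP. reflexivity. Qed.

Lemma gamma_model_no_third : exists v w, [/\ v != w, ~~ medge no_sign v w &
  ~ third_vertex (medge no_sign) v w].
Proof.
(* The trivial characters of the first two spaces agree at the common vector; a search through all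
   vertices finds no third one. *)
exists (ord0, ord0), (Ordinal (isT : 1 < 15), ord0); split=> //.
apply/third_checkP. reflexivity.
Qed.

(** * The quantum isomorphism of the models *)

Lemma forall_ord n (P : pred nat) : all P (iota 0 n) -> forall i : 'I_n, P i.
Proof. by move=> /allP h i; apply: h; rewrite mem_iota ltn_ord. Qed.

Lemma forall_ord2 m n (P : nat -> nat -> bool) :
  all (fun i => all (P i) (iota 0 n)) (iota 0 m) -> forall (i : 'I_m) (j : 'I_n), P i j.
Proof. by move=> h i; apply: forall_ord; exact: (forall_ord h). Qed.

Lemma xor4_lt (i j : 'I_8) : xor4 i j < 8.
Proof. exact: (forall_ord2 (P := fun i j => xor4 i j < 8)). Qed.

(** The group law on characters: addition in F_2^3. *)
Definition xor8 (i j : 'I_8) : 'I_8 := Ordinal (xor4_lt i j).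

Lemma xor8C i j : xor8 i j = xor8 j i.
Proof.
apply: val_inj; apply/eqP.
exact: (forall_ord2 (P := fun i j => xor4 i j == xor4 j i)).
Qed.

Lemma xor8K i : involutive (xor8 i).
Proof.
move=> j; apply: val_inj; apply/eqP => /=.
exact: (forall_ord2 (P := fun i j => xor4 i (xor4 i j) == j)).
Qed.

Lemma dot3_xor (m : nat) (i j : 'I_8) : dot3 m (xor8 i j) = dot3 m i (+) dot3 m j.
Proof.
have /and3P[/eqP e0 /eqP e1 /eqP e2] := forall_ord2 (m := 8) (n := 8)
  (P := fun i j => [&& odd (xor4 i j) == odd i (+) odd j,
    odd (xor4 i j)./2 == odd i./2 (+) odd j./2 &
    odd (xor4 i j)./2./2 == odd i./2./2 (+) odd j./2./2]) isT i j.
rewrite /dot3 [nat_of_ord (xor8 i j)]/(xor4 i j) e0 e1 e2.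
by case: (odd m) (odd m./2) (odd m./2./2) => [] [] [] /=;
   case: (odd i) (odd i./2) (odd i./2./2) => [] [] [];
   case: (odd j) (odd j./2) (odd j./2./2) => [] [] [].
Qed.

(** * The block-diagonal intertwiner built from projections *)

Section Intertwiner.
Local Open Scope ring_scope.
Variables (A : nzRingType) (P : nat -> nat -> A) (c : nat -> nat -> bool).
Hypothesis sumP : forall p : 'I_15, \sum_(i < 8) P p i = 1.
(** For the frames of E8, both sides are the projection onto one eigenspace of the Pauli matrix of
    the common vector, once in the frame of q and once in that of p; [c] compares the sign
    conventions of the two frames. *)
Hypothesis halfP : forall (p q : 'I_15) (s : bool), p != q ->
  \sum_(k < 8 | dot3 (line q p) k == s) P q k =
  \sum_(l < 8 | dot3 (line p q) l == s (+) c p q) P p l.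

(** Each block is a Latin square in its eight projections, whence rows and columns sum to 1. *)
Definition umat (v w : V) : A := if v.1 == w.1 then P v.1 (xor8 v.2 w.2) else 0.

Lemma umatE p i q j : umat (p, i) (q, j) = if p == q then P p (xor8 i j) else 0.
Proof. by []. Qed.

Lemma sum_umatl (G : V -> A) (q : 'I_15) (j : 'I_8) :
  \sum_k G k * umat k (q, j) = \sum_(k < 8) G (q, k) * P q (xor8 j k).
Proof.
transitivity (\sum_p \sum_i G (p, i) * umat (p, i) (q, j)).
  by rewrite pair_bigA; apply: eq_bigr => -[].
rewrite (bigD1 q) // -[RHS]addr0; congr (_ + _).
  by apply: eq_bigr => k _; rewrite umatE eqxx xor8C.
by apply: big1 => p /negPf pq; apply: big1 => i _; rewrite umatE pq mulr0.
Qed.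

Lemma sum_umatr (G : V -> A) (p : 'I_15) (i : 'I_8) :
  \sum_k umat (p, i) k * G k = \sum_(k < 8) P p (xor8 i k) * G (p, k).
Proof.
transitivity (\sum_q \sum_j umat (p, i) (q, j) * G (q, j)).
  by rewrite pair_bigA; apply: eq_bigr => -[].
rewrite (bigD1 p) // -[RHS]addr0; congr (_ + _).
  by apply: eq_bigr => k _; rewrite umatE eqxx.
by apply: big1 => q /negPf pq; apply: big1 => j _; rewrite umatE eq_sym pq mul0r.
Qed.

(** Multiplication by a fixed character permutes the indices. *)
Lemma sum_xor (p : nat) (B : pred 'I_8) (i : 'I_8) :
  \sum_(k | B (xor8 i k)) P p (xor8 i k) = \sum_(k | B k) P p k.
Proof.
by rewrite [RHS](reindex_inj (inv_inj (xor8K i))).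
Qed.

Lemma umat_row v : \sum_w umat v w = 1.
Proof.
case: v => p i; under eq_bigr do rewrite -[umat _ _]mulr1.
rewrite (sum_umatr (fun=> 1)); under eq_bigr do rewrite mulr1.
by rewrite (sum_xor p predT) sumP.
Qed.

Lemma umat_col w : \sum_v umat v w = 1.
Proof.
case: w => p i; under eq_bigr do rewrite -[umat _ _]mul1r.
rewrite (sum_umatl (fun=> 1)); under eq_bigr do rewrite mul1r.
by rewrite (sum_xor p predT) sumP.
Qed.

Lemma sum_but_one (p : 'I_15) (i j : 'I_8) :
  \sum_(k < 8 | k != j) P p (xor8 i k) = 1 - P p (xor8 i j).
Proof.
have e : \sum_(k < 8) P p (xor8 i k) = 1 by rewrite (sum_xor p predT) sumP.
by apply/eqP; rewrite eq_sym subr_eq addrC -e (bigD1 j).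
Qed.

Lemma medgeE (d : nat -> nat -> bool) (p q : 'I_15) (i j : 'I_8) :
  medge d (p, i) (q, j) = if p == q then i != j
    else dot3 (line p q) i (+) dot3 (line q p) j (+) d p q.
Proof. by []. Qed.

Lemma umat_intertwines v w :
  \sum_k (medge c v k)%:R * umat k w = \sum_l umat v l * (medge no_sign l w)%:R.
Proof.
case: v w => p i [q j]; rewrite sum_umatl sum_umatr.
have -> : \sum_(k < 8) (medge c (p, i) (q, k))%:R * P q (xor8 j k) =
    \sum_(k < 8 | medge c (p, i) (q, k)) P q (xor8 j k).
  by rewrite [RHS]big_mkcond; apply: eq_bigr => k _; rewrite mulr_natl mulrb.
have -> : \sum_(k < 8) P p (xor8 i k) * (medge no_sign (p, k) (q, j))%:R =
    \sum_(k < 8 | medge no_sign (p, k) (q, j)) P p (xor8 i k).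
  by rewrite [RHS]big_mkcond; apply: eq_bigr => k _; rewrite mulr_natr mulrb.
under eq_bigl do rewrite medgeE; under [RHS]eq_bigl do rewrite medgeE.
(* Inside a block both graphs are complete, and both sides are 1 minus the same projection. *)
have [<-|pq] := eqVneq p q.
  by under eq_bigl do rewrite eq_sym; rewrite !sum_but_one xor8C.
(* Solving the adjacency condition for k fixes the sign of the shifted index at the common vector:
   it is [s] on the left and [s (+) c p q] on the right. *)
pose s := ~~ (c p q (+) dot3 (line p q) i (+) dot3 (line q p) j).
rewrite (eq_bigl (fun k => dot3 (line q p) (xor8 j k) == s)); last first.
  move=> k; rewrite dot3_xor /s.
  by case: (c p q) (dot3 _ i) (dot3 _ j) (dot3 _ k) => [] [] [] [].
rewrite (sum_xor q (fun k => dot3 (line q p) k == s)) halfP //.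
rewrite -(sum_xor p (fun k => dot3 (line p q) k == s (+) c p q) i).
apply: eq_bigl => k; rewrite dot3_xor /s /no_sign.
by case: (c p q) (dot3 _ i) (dot3 _ j) (dot3 _ k) => [] [] [] [].
Qed.

End Intertwiner.

(** * Projections onto the lines of E8, checked over the integers *)

Definition rootv (v : nat * nat) : seq nat := nth [::] root_table (v.1 * 8 + v.2).

Definition zcoord (t : nat) : Z := Z.sub (Z.of_nat t) (Z.of_nat 1).

(* Entries of 8 times the orthogonal projection onto the line of a root; roots have
   squared norm 2 in the first seven blocks and 8 in the others. *)
Definition proj8 (p i a b : nat) : Z :=
  Z.mul (Z.of_nat (if p < 7 then 4 else 1))
    (Z.mul (zcoord (nth 1 (rootv (p, i)) a)) (zcoord (nth 1 (rootv (p, i)) b))).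

Definition zsum (B : pred nat) (F : nat -> Z) : Z :=
  foldr (fun k s => if B k then Z.add (F k) s else s) Z0 (iota 0 8).

(** Scaling by 8 keeps the entries integral: the matrices M of a frame sum to 8 times the identity,
    and idempotence reads M^2 = 8M. *)
Definition proj_check : bool :=
  all (fun p => all (fun a => all (fun b =>
    Z.eqb (zsum predT (fun i => proj8 p i a b)) (Z.of_nat (if a == b then 8 else 0)) &&
    all (fun i => Z.eqb (zsum predT (fun k => Z.mul (proj8 p i a k) (proj8 p i k b)))
                    (Z.mul (Z.of_nat 8) (proj8 p i a b))) (iota 0 8))
  (iota 0 8)) (iota 0 8)) (iota 0 15).

Definition half_check : bool :=
  all (fun p => all (fun q => (p == q) || all (fun a => all (fun b => all (fun s =>
    Z.eqb (zsum (fun k => dot3 (line q p) k == s) (fun k => proj8 q k a b))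
          (zsum (fun l => dot3 (line p q) l == s (+) e8_sign p q) (fun l => proj8 p l a b)))
  [:: false; true]) (iota 0 8)) (iota 0 8)) (iota 0 15)) (iota 0 15).

Lemma proj_checkT : proj_check. Proof. by vm_compute. Qed.
Lemma half_checkT : half_check. Proof. by vm_compute. Qed.

Section Projections.
Local Open Scope ring_scope.

Definition zr (z : Z) : CC := (int_of_Z z)%:~R.

Lemma zrD x y : zr (Z.add x y) = zr x + zr y.
Proof. by rewrite /zr -[Z.add x y]/(x + y) rmorphD rmorphD. Qed.

Lemma zrM x y : zr (Z.mul x y) = zr x * zr y.
Proof. by rewrite /zr -[Z.mul x y]/(x * y) rmorphM rmorphM. Qed.

Lemma zr_zsum B F : zr (zsum B F) = \sum_(k < 8 | B k) zr (F k).
Proof.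
rewrite -(big_mkord B (fun k => zr (F k))) /index_iota subn0 /zsum.
elim: (iota 0 8) => [|k s IH]; first by rewrite big_nil.
by rewrite big_cons /=; case: (B k); rewrite ?zrD IH.
Qed.

Definition proj (p i : nat) : 'M[CC]_8 := \matrix_(a, b) (zr (proj8 p i a b) / 8).

Lemma proj_checkP (p : 'I_15) (a b : 'I_8) :
  zsum predT (fun i => proj8 p i a b) = Z.of_nat (if a == b then 8 else 0) /\
  forall i : 'I_8, zsum predT (fun k => Z.mul (proj8 p i a k) (proj8 p i k b)) =
    Z.mul (Z.of_nat 8) (proj8 p i a b).
Proof.
have /andP[/Z.eqb_eq h1 h2] := forall_ord2 (forall_ord proj_checkT p) a b.
by split=> // i; apply/Z.eqb_eq; exact: (forall_ord h2).
Qed.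

Lemma eight_neq0 : (8 : CC) != 0. Proof. by rewrite pnatr_eq0. Qed.

Lemma zr8 : zr (Z.of_nat 8) = 8. Proof. by []. Qed.

Lemma sum_proj (p : 'I_15) : \sum_(i < 8) proj p i = 1.
Proof.
apply/matrixP => a b; rewrite summxE mxE.
under eq_bigr do rewrite mxE.
rewrite -mulr_suml -(zr_zsum predT (fun i => proj8 p i a b)) (proj_checkP p a b).1.
by case: eqP => _; rewrite ?zr8 ?divff ?eight_neq0 // mul0r.
Qed.

Lemma proj_idem (p : 'I_15) (i : 'I_8) : proj p i * proj p i = proj p i.
Proof.
apply/matrixP => a b; rewrite !mxE.
under eq_bigr do rewrite !mxE mulf_div -zrM.
rewrite -mulr_suml -(zr_zsum predT (fun k => Z.mul (proj8 p i a k) (proj8 p i k b))).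
rewrite (proj_checkP p a b).2 zrM zr8.
by field.
Qed.

Lemma proj_star p i : mstar (proj p i) = proj p i.
Proof.
apply/matrixP => a b; rewrite !mxE /proj8 (Z.mul_comm (zcoord _)).
by rewrite rmorphM fmorphV /= rmorph_nat rmorph_int.
Qed.

Lemma proj_half (p q : 'I_15) (s : bool) : p != q ->
  \sum_(k < 8 | dot3 (line q p) k == s) proj q k =
  \sum_(l < 8 | dot3 (line p q) l == s (+) e8_sign p q) proj p l.
Proof.
move=> /negPf pq; apply/matrixP => a b; rewrite !summxE.
under eq_bigr do rewrite mxE; under [RHS]eq_bigr do rewrite mxE.
rewrite -!mulr_suml -(zr_zsum (fun k => dot3 (line q p) k == s) (fun k => proj8 q k a b)).
rewrite -(zr_zsum (fun l => dot3 (line p q) l == s (+) e8_sign p q)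
  (fun l => proj8 p l a b)).
congr (zr _ / _); apply/Z.eqb_eq.
have /orP[|h] := forall_ord2 half_checkT p q; first by rewrite val_eqE pq.
by have /allP := forall_ord2 h a b; apply; case: s.
Qed.

Lemma model_quantum_isomorphic :
  quantum_isomorphic (medge e8_sign) (medge no_sign).
Proof.
split=> //; exists (matrix_cstar 7), (umat proj : V -> V -> matrix_cstar 7).
split; last exact: umat_intertwines sum_proj proj_half.
split=> [v w|].
  rewrite /umat; case: ifP => _; first by rewrite [RHS]proj_star.
  by apply/matrixP => a b; rewrite !mxE rmorph0.
split=> [v w|]; last by split=> v; [exact: umat_row sum_proj _|exact: umat_col sum_proj _].
by rewrite /umat; case: ifP => _; [exact: proj_idem|exact: mulr0].
Qed.

End Projections.

(** * Transport of the graph properties along isomorphisms *)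

Section Transport.
Variables (T1 T2 : finType) (e1 : rel T1) (e2 : rel T2).

Lemma isomorphic_sym : isomorphic e1 e2 -> isomorphic e2 e1.
Proof.
move=> [f [[g fK gK] ef]]; exists g; split; first by exists f.
by move=> x y; rewrite ef !gK.
Qed.

Lemma isomorphic_trans (T3 : finType) (e3 : rel T3) :
  isomorphic e1 e2 -> isomorphic e2 e3 -> isomorphic e1 e3.
Proof.
move=> [f [bf ef]] [g [bg eg]]; exists (g \o f); split; first exact: bij_comp.
by move=> x y; rewrite ef eg.
Qed.

Lemma srg_isomorphic n k l m : isomorphic e1 e2 -> srg_with e2 n k l m ->
  srg_with e1 n k l m.
Proof.
move=> [f [bf ef]] [cn ck cl cm].
have card_pre (B : pred T2) : #|[set x | B (f x)]| = #|[set y | B y]|.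
  rewrite -(card_imset _ (bij_inj bf)); apply: eq_card => y; rewrite [RHS]inE.
  apply/imsetP/idP => [[x + ->]|By]; first by rewrite inE.
  by have [g _ gK] := bf; exists (g y); rewrite ?inE gK.
have com x y : #|[set z | e1 x z && e1 y z]| = #|[set z | e2 (f x) z && e2 (f y) z]|.
  by rewrite -card_pre; apply: eq_card => z; rewrite !inE !ef.
split.
- by rewrite -cn (bij_eq_card bf).
- by move=> x; rewrite -(ck (f x)) -card_pre; apply: eq_card => z; rewrite !inE ef.
- by move=> x y; rewrite -(inj_eq (bij_inj bf)) ef com; exact: cl.
- by move=> x y; rewrite -(inj_eq (bij_inj bf)) ef com; exact: cm.
Qed.

Lemma third_vertex_iso (f : T1 -> T2) x y : bijective f ->
  (forall x y, e1 x y = e2 (f x) (f y)) ->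
  third_vertex e1 x y -> third_vertex e2 (f x) (f y).
Proof.
move=> bf ef [z [zx zy h]]; exists (f z); rewrite !(bij_eq bf); split=> // u.
by have [g _ gK] := bf; rewrite -(gK u) -!ef; exact: h.
Qed.

End Transport.

Section QuantumTransport.
Local Open Scope ring_scope.

Lemma quantum_isomorphic_transport (T1 T2 S1 S2 : finType) (e1 : rel T1) (e2 : rel T2)
    (d1 : rel S1) (d2 : rel S2) :
  isomorphic e1 d1 -> isomorphic e2 d2 ->
  quantum_isomorphic d1 d2 -> quantum_isomorphic e1 e2.
Proof.
move=> [f [bf ef]] [g [bg eg]] [c [A [u [[us [ui [ur uc]]] ui12]]]].
split; first by rewrite (bij_eq_card bf) c (bij_eq_card bg).
exists A, (fun x y => u (f x) (g y)); split; last first.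
  move=> i j; have := ui12 (f i) (g j).
  rewrite (reindex f) ?(reindex g) /=; try exact: onW_bij.
  by under eq_bigr do rewrite -ef; under [RHS]eq_bigr do rewrite -eg.
split=> //; split=> //; split=> [i|j].
- by rewrite -(ur (f i)) (reindex g) //; exact: onW_bij.
- by rewrite -(uc (g j)) (reindex f) //; exact: onW_bij.
Qed.

End QuantumTransport.

(** * The lines of E8 *)

Definition vec_seq (n : nat) (x : {ffun 'I_8 -> 'I_n}) : seq nat :=
  [seq nat_of_ord (x i) | i <- enum 'I_8].

Definition zneg (t : nat) : nat := 2 - t.

Definition zroot (s : seq nat) : bool :=
  (count (fun t => t != 1) s == 2) || all (fun t => t != 1) s &&
    Z.eqb (foldr (fun t z => Z.mul (zcoord t) z) (Z.of_nat 1) s) (Z.of_nat 1).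

Definition zdot (s t : seq nat) : Z :=
  foldr (fun p z => Z.add (Z.mul (zcoord p.1) (zcoord p.2)) z) Z0 (zip s t).

Lemma coord_zcoord (t : 'I_3) : Defs.coord t = int_of_Z (zcoord t).
Proof. by case: t => -[|[|[]]]. Qed.

Lemma coord_neq0 (t : 'I_3) : (Defs.coord t != 0%R) = (t != 1 :> nat).
Proof. by case: t => -[|[|[]]]. Qed.

Lemma e8_root_zroot x : e8_root x = zroot (vec_seq x).
Proof.
rewrite /e8_root /zroot /vec_seq; congr (_ || _ && _).
- rewrite count_map enumT cardsE cardE /enum_mem size_filter; congr (_ == _).
  by apply: eq_count => i; exact: coord_neq0 (x i).
- rewrite all_map; apply/forallP/allP => [h i _|h i]; rewrite /= ?coord_neq0.
    by rewrite -coord_neq0.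
  by have := h i; rewrite /= mem_enum => ->.
- rewrite -big_enum /= -[1%R]/(int_of_Z (Z.of_nat 1)).
  have -> : (\prod_(i <- enum 'I_8) Defs.coord (x i))%R = int_of_Z (foldr
     (fun t z => Z.mul (zcoord t) z) (Z.of_nat 1) [seq nat_of_ord (x i) | i <- enum 'I_8]).
    elim: (enum 'I_8) => [|i s IH]; first by rewrite big_nil.
    by rewrite big_cons IH coord_zcoord -rmorphM.
  by rewrite (can_eq int_of_ZK); apply/eqP/idP => [->|/Z.eqb_eq //]; exact: Z.eqb_refl.
Qed.

Lemma e8inner_zdot x y : e8inner x y = int_of_Z (zdot (vec_seq x) (vec_seq y)).
Proof.
rewrite /e8inner -big_enum /= /vec_seq /zdot zip_map.
elim: (enum 'I_8) => [|i s IH]; first by rewrite big_nil.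
by rewrite big_cons IH !coord_zcoord -rmorphM -rmorphD.
Qed.

Lemma vec_seq_neg x : vec_seq (e8neg x) = map zneg (vec_seq x).
Proof. by rewrite /vec_seq -map_comp; apply: eq_map => i; rewrite /= ffunE /= subSS. Qed.

Lemma vec_seq_inj n : injective (@vec_seq n).
Proof.
move=> x y e; apply/ffunP => i; apply: val_inj.
by move/eq_in_map: e; apply; rewrite mem_enum.
Qed.

Definition seq_vec n (s : seq nat) : {ffun 'I_8 -> 'I_n.+1} := [ffun i : 'I_8 => inord (nth 0 s i)].

Lemma seq_vecK n s : size s = 8 -> all (fun t => t < n.+1) s -> vec_seq (seq_vec n s) = s.
Proof.
move=> s8 /allP h; apply: (@eq_from_nth _ 0); first by rewrite size_map size_enum_ord.
rewrite size_map size_enum_ord => i i8; rewrite (nth_map ord0) ?size_enum_ord // ffunE.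
by rewrite nth_enum_ord // inordK // ltnS; apply: h; rewrite mem_nth ?s8.
Qed.

Fixpoint words (k n : nat) : seq (seq nat) :=
  if n is n'.+1 then [seq t :: s | t <- iota 0 k, s <- words k n'] else [:: [::]].

Lemma mem_words k n s : size s = n -> all (fun t => t < k) s -> s \in words k n.
Proof.
elim: n s => [|n IH] [] //= t s [sn] /andP[tk sk].
by apply/allpairsP; exists (t, s); rewrite mem_iota tk IH.
Qed.

Lemma vec_seq_words n (x : {ffun 'I_8 -> 'I_n}) : vec_seq x \in words n 8.
Proof.
apply: mem_words; first by rewrite size_map size_enum_ord.
by apply/allP => _ /mapP[i _ ->].
Qed.

(** An exhaustive search through the 3^8 vectors with coordinates -1, 0, 1; one sign of each root
    suffices, as vertices are lines. *)
Definition roots_complete : bool :=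
  all (fun s => zroot s ==> (s \in root_table) || (map zneg s \in root_table)) (words 3 8).

(** The second conjunct fixes the order of the table, so that each of its entries is the root of a
    model vertex. *)
Definition roots_sound : bool :=
  all (fun s => [&& size s == 8, all (fun t => t < 3) s & zroot s]) root_table &&
  (root_table == [seq rootv v | v <- mverts]).

Definition roots_adj : bool :=
  all (fun v => all (fun w => madj e8_sign v w == Z.eqb (zdot (rootv v) (rootv w)) Z0)
    mverts) mverts.

Lemma roots_completeT : roots_complete. Proof. by vm_compute. Qed.
Lemma roots_soundT : roots_sound. Proof. by vm_compute. Qed.
Lemma roots_adjT : roots_adj. Proof. by vm_compute. Qed.

Definition model_vec (v : V) : e8vec := seq_vec 2 (rootv (nv v)).

Lemma rootv_table v : rootv (nv v) \in root_table.
Proof.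
have /andP[_ /eqP ->] := roots_soundT.
by apply: map_f; exact: nv_mverts.
Qed.

Lemma vec_seq_model v : vec_seq (model_vec v) = rootv (nv v).
Proof.
have /andP[/allP/(_ _ (rootv_table v)) /and3P[/eqP s8 s3 _] _] := roots_soundT.
exact: seq_vecK.
Qed.

Lemma model_vec_root v : e8_root (model_vec v).
Proof.
rewrite e8_root_zroot vec_seq_model.
by have /andP[/allP/(_ _ (rootv_table v)) /and3P[] ] := roots_soundT.
Qed.

Lemma e8negK : involutive e8neg.
Proof. by move=> x; apply/ffunP => i; rewrite !ffunE rev_ordK. Qed.

Lemma e8inner_negl x y : e8inner (e8neg x) y = (- e8inner x y)%R.
Proof.
have coordN (t : 'I_3) : Defs.coord (rev_ord t) = (- Defs.coord t)%R.
  by case: t => -[|[|[]]].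
rewrite /e8inner -sumrN; apply: eq_bigr => i _.
by rewrite ffunE coordN mulNr.
Qed.

Lemma e8inner_sym x y : e8inner x y = e8inner y x.
Proof. by apply: eq_bigr => i _; rewrite mulrC. Qed.

Lemma e8_vertex_pair x : e8_root x -> e8_vertex [set x; e8neg x].
Proof. by move=> rx; apply/existsP; exists x; rewrite rx eqxx. Qed.

Definition model_e8 (v : V) : GE8 := Sub _ (e8_vertex_pair (model_vec_root v)).

(** Orthogonality is insensitive to the signs of the roots, so the tabulated representatives decide
    it. *)
Lemma model_e8_adj v w : medge e8_sign v w = GE8_adj (model_e8 v) (model_e8 w).
Proof.
have -> : medge e8_sign v w = (e8inner (model_vec v) (model_vec w) == 0%R).
  have /allP/(_ _ (nv_mverts v))/allP/(_ _ (nv_mverts w))/eqP := roots_adjT.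
  rewrite /medge => ->; rewrite e8inner_zdot !vec_seq_model -[0%R]/(int_of_Z Z0).
  by rewrite (can_eq int_of_ZK); apply/idP/eqP => [/Z.eqb_eq|->] //; exact: Z.eqb_refl.
apply/idP/existsP => [h|[x /andP[]]].
  exists (model_vec v); rewrite !inE eqxx /=.
  by apply/existsP; exists (model_vec w); rewrite !inE eqxx.
rewrite !inE => hx /existsP[y /andP[]]; rewrite !inE => hy.
case/orP: hx => /eqP ->; case/orP: hy => /eqP -> //;
by rewrite ?e8inner_negl ?(e8inner_sym _ (e8neg _)) ?e8inner_negl ?oppr_eq0 // e8inner_sym.
Qed.

Lemma model_e8_surj S : exists v, model_e8 v = S.
Proof.
case: S => S hS; have /existsP[x /andP[rx /eqP eS]] := hS.
have mem y : e8_root y -> vec_seq y \in root_table -> exists v, model_vec v = y.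
  move=> _; have /andP[_ /eqP ->] := roots_soundT.
  case/mapP => _ /mvertsP[v ->] e; exists v.
  by apply: vec_seq_inj; rewrite vec_seq_model.
have /allP/(_ _ (vec_seq_words x)) := roots_completeT.
rewrite -e8_root_zroot rx /= -vec_seq_neg => /orP[/mem|] h.
  by have [v e] := h rx; exists v; apply: val_inj; rewrite /= e eS.
(* Otherwise -x is tabulated, and it spans the same line. *)
have rn : e8_root (e8neg x).
  have /andP[/allP/(_ _ h) /and3P[_ _] + _] := roots_soundT.
  by rewrite -e8_root_zroot.
have [v e] := mem _ rn h; exists v; apply: val_inj.
by rewrite /= e e8negK finset.setUC eS.
Qed.

(* An SRG(120,63,30,36) has no twins, so a surjection that preserves its adjacency
   in both directions is injective. *)
Lemma twinless_surjection (T : finType) (e : rel T) c (f : V -> T) :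
  srg_with (medge c) 120 63 30 36 -> (forall y, exists x, f x = y) ->
  (forall v w, medge c v w = e (f v) (f w)) -> isomorphic (medge c) e.
Proof.
move=> [_ ck cl cm] sf ef; exists f; split=> //.
have fi : injective f.
  move=> v w fvw; apply/eqP; apply: contraT => vw.
  (* Vertices with the same image would have 63 common neighbours instead of 30 or 36. *)
  have : #|[set z | medge c v z && medge c w z]| = 63.
    by rewrite -(ck v); apply: eq_card => z; rewrite !inE !ef fvw andbb.
  by case e1 : (medge c v w); [rewrite cl|rewrite cm ?e1].
have [g gK] := boolp.choice sf; exists g => // v.
by apply: fi; rewrite gK.
Qed.

Lemma e8_isomorphic_model : isomorphic (medge e8_sign) GE8_adj.
Proof. exact: twinless_surjection srg_e8_model model_e8_surj model_e8_adj. Qed.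

(** * The graph of cosets *)

Definition bw (x : bvec) : seq bool := [seq x i | i <- enum 'I_8].

Definition wv (w : seq bool) : bvec := [ffun i : 'I_8 => nth false w i].

Definition xorw (s t : seq bool) : seq bool := [seq p.1 (+) p.2 | p <- zip s t].

Lemma size_bw x : size (bw x) = 8. Proof. by rewrite size_map size_enum_ord. Qed.

Lemma nth_bw x (i : 'I_8) : nth false (bw x) i = x i.
Proof. by rewrite (nth_map ord0) ?size_enum_ord // nth_ord_enum. Qed.

Lemma bwK : cancel bw wv.
Proof. by move=> x; apply/ffunP => i; rewrite ffunE nth_bw. Qed.

Lemma wvK w : size w = 8 -> bw (wv w) = w.
Proof.
move=> w8; apply: (@eq_from_nth _ false); rewrite size_bw ?w8 // => i i8.
by rewrite (nth_bw _ (Ordinal i8)) ffunE.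
Qed.

Lemma bw_add x y : bw (addv x y) = xorw (bw x) (bw y).
Proof. by rewrite /xorw /bw zip_map -map_comp; apply: eq_map => i; rewrite /= ffunE. Qed.

Lemma weight_bw x : weight x = count id (bw x).
Proof. by rewrite count_map enumT /weight cardsE cardE /enum_mem size_filter. Qed.

Lemma bvaddC x y : addv x y = addv y x.
Proof. by apply/ffunP => i; rewrite !ffunE addbC. Qed.

Lemma bvaddA x y z : addv x (addv y z) = addv (addv x y) z.
Proof. by apply/ffunP => i; rewrite !ffunE addbA. Qed.

Lemma bvaddK x y : addv x (addv x y) = y.
Proof. by apply/ffunP => i; rewrite !ffunE addbA addbb. Qed.

Lemma bvaddCA x y z : addv x (addv y z) = addv y (addv x z).
Proof. by rewrite !bvaddA (bvaddC x). Qed.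

Lemma odd_weight_add x y : odd (weight (addv x y)) = odd (weight x) (+) odd (weight y).
Proof.
rewrite !weight_bw bw_add /bw /xorw zip_map -map_comp.
elim: (enum 'I_8) => //= i s IH.
by rewrite !oddD IH !oddb addbACA.
Qed.

Lemma even_add x y : evenv x -> evenv y -> evenv (addv x y).
Proof. by rewrite /evenv odd_weight_add => /negPf -> /negPf ->. Qed.

Lemma weight_onev : weight onev = 8.
Proof. by rewrite /weight (eq_card (B := 'I_8)) ?card_ord // => i; rewrite !inE ffunE. Qed.

Lemma onevE x i : addv onev x i = ~~ x i.
Proof. by rewrite !ffunE. Qed.

(** * Vertices of the folded halved cube and the group acting on them *)

Definition pairS (x : bvec) : {set bvec} := [set x; addv onev x].

Lemma pairS_onev x : pairS (addv onev x) = pairS x.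
Proof. by rewrite /pairS bvaddK finset.setUC. Qed.

Lemma mem_pairS x : x \in pairS x. Proof. by rewrite !inE eqxx. Qed.

Lemma pairS_eq x y : pairS x = pairS y -> x = y \/ x = addv onev y.
Proof.
by move=> e; have := mem_pairS x; rewrite e !inE => /orP[] /eqP; [left|right].
Qed.

(** Words with first letter 0 are a transversal modulo the all-one word. *)
Lemma pairS_inj : {in [pred x : bvec | ~~ x ord0] &, injective pairS}.
Proof.
move=> x y; rewrite !inE => x0 y0 /pairS_eq[//|e].
by move: x0; rewrite e !ffunE (negPf y0).
Qed.

Definition pm (s : {perm 'I_8}) (x : bvec) : bvec := [ffun i => x (s^-1 i)%g].

Lemma pm_add s x y : pm s (addv x y) = addv (pm s x) (pm s y).
Proof. by apply/ffunP => i; rewrite !ffunE. Qed.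

Lemma gmapE s t x : gmap s t x = addv (pm s x) t. Proof. by []. Qed.

Lemma pm_mul s t x : pm (s * t)%g x = pm t (pm s x).
Proof. by apply/ffunP => i; rewrite !ffunE invMg permM. Qed.

Lemma pm_one x : pm 1%g x = x.
Proof. by apply/ffunP => i; rewrite !ffunE invg1 perm1. Qed.

Lemma pm_onev s : pm s onev = onev.
Proof. by apply/ffunP => i; rewrite !ffunE. Qed.

Lemma even_pm s x : evenv (pm s x) = evenv x.
Proof.
rewrite /evenv /weight; congr (~~ odd _).
rewrite -[RHS](card_imset _ (@perm_inj _ s)); apply: eq_card => i; rewrite inE ffunE.
apply/idP/imsetP => [h|[j + ->]]; last by rewrite inE permK.
by exists (s^-1 i)%g; rewrite ?inE // permKV.
Qed.

Lemma gmap_pairS s t x : [set gmap s t y | y in pairS x] = pairS (gmap s t x).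
Proof.
rewrite /pairS imsetU !imset_set1; congr (_ :|: [set _]).
by rewrite !gmapE pm_add pm_onev bvaddA.
Qed.

Lemma gact_pairS s t (X : {set bvec}) :
  gact s t [set pairS x | x in X] = [set pairS (gmap s t x) | x in X].
Proof. by rewrite /gact -imset_comp; apply: eq_imset => x /=; rewrite gmap_pairS. Qed.

(** * Codes and their cosets as lists of words *)

Definition zerow : seq bool := nseq 8 false.
Definition compw (w : seq bool) : seq bool := map negb w.
Definition wordn (n : nat) : seq bool := false :: [seq bit k n | k <- iota 0 7].
Definition swapw (i j : nat) (w : seq bool) : seq bool :=
  mkseq (fun k => nth false w (if k == i then j else if k == j then i else k)) 8.

(* For each block three generators of the code and three representatives which, added
   according to the binary digits of i, give the i-th coset: the characters they induce
   are dual to the generators. A number stands for a word of length 8 that starts with 0,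
   the further letters being its binary digits. *)
Definition code_table : seq (seq nat * seq nat) :=
 [:: ([:: 15; 57; 106], [:: 30; 51; 85]);
     ([:: 51; 30; 106], [:: 57; 15; 85]);
     ([:: 60; 39; 106], [:: 30; 15; 85]);
     ([:: 85; 30; 57], [:: 106; 15; 51]);
     ([:: 90; 57; 116], [:: 30; 51; 15]);
     ([:: 102; 30; 83], [:: 57; 15; 51]);
     ([:: 105; 39; 116], [:: 30; 51; 60]);
     ([:: 15; 51; 85], [:: 30; 57; 106]);
     ([:: 15; 108; 89], [:: 30; 51; 85]);
     ([:: 51; 75; 101], [:: 57; 15; 85]);
     ([:: 60; 114; 101], [:: 75; 15; 85]);
     ([:: 85; 45; 54], [:: 106; 15; 51]);
     ([:: 90; 54; 71], [:: 45; 51; 15]);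
     ([:: 102; 45; 92], [:: 54; 15; 51]);
     ([:: 105; 27; 71], [:: 45; 51; 60])].

Definition comb (gs : seq nat) (i : nat) : seq bool :=
  foldr (fun k w => if bit k i then xorw (wordn (nth 0 gs k)) w else w) zerow (iota 0 3).

(* The two A_8-classes of codes are exchanged by odd permutations; class [true] is
   the image of class [false] under the transposition of the coordinates 1 and 2. *)
Definition flip (b : bool) (w : seq bool) : seq bool := if b then swapw 1 2 w else w.

Definition code (b : bool) (p : nat) : seq (seq bool) :=
  [seq flip b (comb (nth ([::], [::]) code_table p).1 i) | i <- iota 0 8].

Definition rep (b : bool) (v : nat * nat) : seq bool :=
  flip b (comb (nth ([::], [::]) code_table v.1).2 v.2).

Definition code_coset (b : bool) (v : nat * nat) : seq (seq bool) :=
  [seq xorw (rep b v) w | w <- code b v.1].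

(** The preimage of the 3-space in F_2^8, an extended Hamming code of 16 words; [code] keeps the
    half with first letter 0. *)
Definition fcode (b : bool) (p : nat) : seq (seq bool) := code b p ++ map compw (code b p).

Fixpoint bwords (n : nat) : seq (seq bool) :=
  if n is n'.+1 then [seq t :: s | t <- [:: false; true], s <- bwords n'] else [:: [::]].

(** The 35 nonzero singular vectors of Q, each by its representative with first letter 0. *)
Definition weight4_words : seq (seq bool) :=
  [seq w <- [seq false :: w | w <- bwords 7] | count id w == 4].

(** * Exhaustive checks on cliques, codes and cosets *)

Section Cliques.
Variables (T : eqType) (adj : rel T).

(** Cliques are found as subsequences: after its first vertex the search continues among the later
    neighbours only. *)
Fixpoint cliques (n : nat) (l : seq T) : seq (seq T) :=
  if n is n'.+1 then
    (fix go l := if l is v :: l' then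
       [seq v :: c | c <- cliques n' [seq w <- l' | adj v w]] ++ go l' else [::]) l
  else [:: [::]].

Lemma cliquesP c l : subseq c l -> pairwise adj c -> c \in cliques (size c) l.
Proof.
elim: c l => // v c IH l scl /= /andP[avc pc].
elim: l scl => //= w l IHl.
case: eqP => [<-|_] scl; rewrite mem_cat; last by rewrite IHl ?orbT.
by rewrite map_f // IH // subseq_filter avc.
Qed.
End Cliques.

Definition adj4 (s t : seq bool) : bool := count id (xorw s t) == 4.

Definition eqset (s t : seq (seq bool)) : bool :=
  all (fun w => w \in t) s && all (fun w => w \in s) t.

(** Seven singular vectors at mutual distance 4 always form, with 0, one of the 30 totally singular
    3-spaces. *)
Definition clique_check : bool :=
  all (fun c => has (fun b => has (fun p => eqset (zerow :: c) (code b p)) (iota 0 15))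
    [:: false; true]) (cliques adj4 7 weight4_words).

(** Transpositions generate the symmetric group, so they suffice to follow a code under any
    permutation. *)
Definition swap_check (L L' : seq (seq (seq bool))) : bool :=
  all (fun C => all (fun i => all (fun j => (i == j) ||
    has (fun D => all (fun w => swapw i j w \in D) C && all (fun w => swapw i j w \in C) D) L')
  (iota 0 8)) (iota 0 8)) L.

Definition fcodes (b : bool) : seq (seq (seq bool)) := [seq fcode b p | p <- iota 0 15].

(** The listed cosets hold only words with first letter 0, so a word of a translate may have to be
    complemented. *)
Definition cosets_of (C : seq (seq bool)) (K : seq (seq (seq bool))) : bool :=
  all (fun w => odd (count id w) || has (fun D =>
     all (fun u => (xorw w u \in D) || (compw (xorw w u) \in D)) C &&
     all (fun u => xorw w u \in C) D) K) (bwords 8).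

Definition coset_check : bool :=
  all (fun b => all (fun p => cosets_of (fcode b p) [seq code_coset b (p, i) | i <- iota 0 8])
    (iota 0 15)) [:: false; true].

(** A count of 8 means equal sets, so adjacency in the complement of Gamma_1 excludes the counts 2
    and 8. *)
Definition inter_check (K : seq (nat * nat * seq (seq bool))) : bool :=
  all (fun r => all (fun s =>
    (fun n => (madj no_sign r.1 s.1 == (n != 2) && (n != 8)) && ((r.1 == s.1) ==> (n == 8)))
      (count (fun u => u \in s.2) r.2)) K) K.

Definition coset_list (b : bool) : seq (nat * nat * seq (seq bool)) :=
  [seq (v, code_coset b v) | v <- mverts].

Definition code_check : bool :=
  all (fun b => all (fun v =>
    uniq (code_coset b v) && all (fun w => (size w == 8) && ~~ head true w) (code_coset b v))
  mverts) [:: false; true].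

Lemma clique_checkT : clique_check. Proof. reflexivity. Qed.
Lemma swap_checkT b : swap_check (fcodes b) (fcodes (~~ b)).
Proof. case: b. reflexivity. reflexivity. Qed.
Lemma coset_checkT : coset_check. Proof. reflexivity. Qed.
Lemma inter_checkT b : inter_check (coset_list b).
Proof. case: b. reflexivity. reflexivity. Qed.
Lemma code_checkT : code_check. Proof. reflexivity. Qed.

Lemma mem_bwords s : s \in bwords (size s).
Proof.
elim: s => // a s IH.
change (a :: s \in [seq t :: u | t <- [:: false; true], u <- bwords (size s)]).
by apply/allpairsP; exists (a, s); split=> //; case: a.
Qed.

(** * Even permutations and translations acting on cosets of codes *)

Definition ws (L : seq (seq bool)) : {set bvec} := [set y | bw y \in L].

Lemma in_ws y L : (y \in ws L) = (bw y \in L).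
Proof. by rewrite inE. Qed.

Definition Jc (b : bool) (p : nat) (x : bvec) : {set {set bvec}} :=
  [set pairS (addv x y) | y in ws (fcode b p)].

Definition in_class (b : bool) (J : {set {set bvec}}) : Prop :=
  exists (p : 'I_15) (x : bvec), evenv x /\ J = Jc b p x.

Lemma bw_tperm i j x : bw (pm (tperm i j) x) = swapw i j (bw x).
Proof.
apply: (@eq_from_nth _ false); first by rewrite size_bw size_mkseq.
rewrite size_bw => k k8; rewrite nth_mkseq // (nth_bw _ (Ordinal k8)) ffunE tpermV.
case: tpermP => [<-|<-|/eqP ki /eqP kj]; rewrite /= ?eqxx ?nth_bw //.
  case: eqP => [e|_]; last by rewrite nth_bw.
  by rewrite (nth_bw _ (Ordinal k8)); congr (x _); apply: val_inj; rewrite /= -e.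
rewrite -!val_eqE /= in ki kj; rewrite (negPf ki) (negPf kj).
by rewrite (nth_bw _ (Ordinal k8)).
Qed.

Lemma swap_class (i j : 'I_8) b (p : 'I_15) : i != j ->
  exists q : 'I_15, [set pm (tperm i j) y | y in ws (fcode b p)] = ws (fcode (~~ b) q).
Proof.
move=> ij; have pin : fcode b p \in fcodes b by apply: map_f; rewrite mem_iota ltn_ord.
have /allP/(_ _ pin) h := swap_checkT b.
have /orP[|/hasP[_ /mapP[q + ->]]] := forall_ord2 h i j; first by rewrite val_eqE (negPf ij).
rewrite mem_iota => /andP[_ q15] /andP[/allP h1 /allP h2]; exists (Ordinal q15).
apply/setP => y; rewrite inE; apply/imsetP/idP => [[z + ->]|hy].
  by rewrite inE bw_tperm; exact: h1.
exists (pm (tperm i j) y); first by rewrite inE bw_tperm; exact: h2.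
by rewrite -pm_mul tperm2 pm_one.
Qed.

(** Induction on a factorization of s into transpositions, each of which exchanges the two
    classes. *)
Lemma pm_class s b (p : 'I_15) : exists q : 'I_15,
  [set pm s y | y in ws (fcode b p)] = ws (fcode (b (+) odd_perm s) q).
Proof.
have [ts -> /allP dts] := prod_tpermP s.
elim: ts dts b p => [|[i j] ts IH] dts b p.
  rewrite big_nil odd_perm1 addbF; exists p.
  by rewrite (eq_imset _ (g := id)) ?imset_id // => x; exact: pm_one.
have ij : i != j by have := dts (i, j); rewrite inE eqxx => /(_ isT).
have [q eq] := swap_class b p ij.
have [|r er] := IH _ (~~ b) q; first by move=> t tin; apply: dts; rewrite inE tin orbT.
exists r; rewrite big_cons odd_permM odd_tperm /= ij addbA addbT -er -eq -imset_comp.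
by apply: eq_imset => x; rewrite /= pm_mul.
Qed.

Lemma gact_class s t b J : ~~ odd_perm s -> evenv t -> in_class b J ->
  in_class b (gact s t J).
Proof.
move=> /negPf os et [p [x [ex ->]]].
have [q] := pm_class s b p; rewrite os addbF => eq.
exists q, (addv (pm s x) t); split; first by rewrite even_add ?even_pm.
have -> : Jc b p x = [set pairS z | z in [set addv x y | y in ws (fcode b p)]].
  by rewrite -imset_comp.
rewrite gact_pairS /Jc -eq -!imset_comp; apply: eq_imset => y /=.
by rewrite gmapE pm_add -!bvaddA (bvaddC t).
Qed.

Definition Jm (b : bool) (v : V) : {set {set bvec}} :=
  [set pairS y | y in ws (code_coset b (nv v))].

Lemma bw_onev x : bw (addv onev x) = compw (bw x).
Proof. by rewrite /compw -map_comp; apply: eq_map => i; rewrite !ffunE. Qed.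

Lemma in_class_Jm b J : in_class b J -> exists v, J = Jm b v.
Proof.
move=> [p [x [ex ->]]].
have bin : b \in [:: false; true] by case: b.
have pin : (p : nat) \in iota 0 15 by rewrite mem_iota ltn_ord.
have /allP/(_ _ bin)/allP/(_ _ pin)/allP/(_ (bw x)) := coset_checkT.
have xin : bw x \in bwords 8 by rewrite -(size_bw x) mem_bwords.
move=> /(_ xin); rewrite -weight_bw (negPf ex) => /orP[//|/hasP[_ /mapP[i + ->]]].
rewrite mem_iota => /andP[_ i8] /andP[/allP h1 /allP h2].
exists (p, Ordinal i8); apply/setP => S; apply/imsetP/imsetP => [[y + ->]|[y + ->]].
  rewrite inE => /h1; rewrite -bw_add => /orP[h|].
    by exists (addv x y) => //; rewrite inE; exact: h.
  rewrite -bw_onev => h; exists (addv onev (addv x y)); rewrite ?pairS_onev //.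
  by rewrite inE; exact: h.
rewrite inE => /h2; rewrite -bw_add => h.
by exists (addv x y); [rewrite inE; exact: h|rewrite bvaddK].
Qed.

(** * Independent sets of size 8 are cosets of codes *)

Lemma bw_head_false (y : bvec) : ~~ y ord0 -> bw y \in [seq false :: w | w <- bwords 7].
Proof.
rewrite -(nth_bw y ord0); have := size_bw y; case: (bw y) => // a s [s7] a0.
have -> : a = false by exact: negbTE a0.
by apply: map_f; rewrite -s7 mem_bwords.
Qed.

(** The first letter 0 rules out weight 8; weight 6 is weight 2 of the complement. *)
Lemma weight4 (y : bvec) : ~~ y ord0 -> evenv y -> y != wv zerow ->
  weight y != 2 -> weight (addv y onev) != 2 -> weight y = 4.
Proof.
move=> y0 ey yz y2 y6; apply/eqP.
have chk : all (fun w => [|| odd (count id w), w == zerow, count id w == 2,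
    count id (compw w) == 2 | count id w == 4]) [seq false :: w | w <- bwords 7] by [].
have /allP/(_ _ (bw_head_false y0)) := chk.
rewrite -bw_onev -!weight_bw (negPf ey) (negPf y2) bvaddC (negPf y6) !orFb.
by case/orP=> // /eqP e; case/eqP: yz; rewrite -e bwK.
Qed.

Lemma wv_inj : {in [pred w | size w == 8] &, injective wv}.
Proof. by move=> s t /eqP s8 /eqP t8 e; rewrite -(wvK s8) -(wvK t8) e. Qed.

Lemma card_ws L : uniq L -> all (fun w => size w == 8) L -> #|ws L| = size L.
Proof.
move=> uL /allP L8; rewrite -(size_map wv L).
have /card_uniqP <- : uniq [seq wv w | w <- L].
  by rewrite map_inj_in_uniq // => s t /L8 ? /L8 ?; apply: wv_inj.
apply: eq_card => y; rewrite inE; apply/idP/mapP => [h|[w wL ->]].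
  by exists (bw y); rewrite ?bwK.
by rewrite wvK //; apply/eqP; exact: L8.
Qed.

Lemma uniq_pairwise_rel (T : eqType) (r : rel T) (s : seq T) : uniq s ->
  {in s &, forall x y, x != y -> r x y} -> pairwise r s.
Proof.
rewrite uniq_pairwise => us h; apply: (sub_in_pairwise (P := mem s)) us; last exact/allP.
by move=> x y xs ys /=; exact: h.
Qed.

Lemma weight4_words_ok : [/\ zerow \notin weight4_words, uniq weight4_words &
  all (fun w => size w == 8) weight4_words].
Proof. by split; vm_compute. Qed.

Lemma mem_weight4_words (y : bvec) : ~~ y ord0 -> weight y = 4 -> bw y \in weight4_words.
Proof. by move=> y0 y4; rewrite mem_filter -weight_bw y4 eqxx bw_head_false. Qed.

(** After a translation one member is the class of 0; the other seven are then words of weight 4 at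
    mutual distance 4, and [clique_checkT] applies. *)
Lemma indep8_code I : indep8 I -> exists b, in_class b I.
Proof.
(* The numeral in [indep8] is read in [ring_scope]; it converts to the natural number 8. *)
case/and3P => /subsetP vI /eqP cI /forallP nI; rewrite -[8%R]/8 in cI.
have [S0 S0I] : exists S, S \in I by apply/set0Pn; rewrite -card_gt0 cI.
have pairP S : S \in I -> exists2 x, evenv x & S = pairS x.
  by move=> /vI; rewrite inE => /existsP[x /andP[ex /eqP ->]]; exists x.
have [x0 ex0 eS0] := pairP _ S0I.
(* The translated set, each vertex by its representative with first letter 0. *)
pose X := [set y : bvec | ~~ y ord0 && (pairS (addv x0 y) \in I)].
have eI : I = [set pairS (addv x0 y) | y in X].
  apply/setP => S; apply/idP/imsetP => [SI|[y + ->]]; last by rewrite inE => /andP[].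
  have [z _ eS] := pairP _ SI.
  have [h|h] := boolP (addv x0 z ord0).
    exists (addv onev (addv x0 z)); last by rewrite bvaddCA bvaddK pairS_onev.
    by rewrite inE (bvaddCA x0 onev) bvaddK pairS_onev -eS SI andbT onevE h.
  by exists (addv x0 z); rewrite ?inE ?h bvaddK -?eS.
have injX : {in X &, injective (fun y => pairS (addv x0 y))}.
  move=> y z; rewrite !inE => /andP[y0 _] /andP[z0 _] /pairS_eq[] e.
    by rewrite -(bvaddK x0 y) e bvaddK.
  by move: y0; rewrite -(bvaddK x0 y) e bvaddCA bvaddK onevE (negPf z0).
have cX : #|X| = 8 by rewrite -[RHS]cI eI card_in_imset.
have evX y : y \in X -> evenv y.
  rewrite inE => /andP[_ /pairP[x ex /pairS_eq e]].
  suff exy : evenv (addv x0 y) by rewrite -(bvaddK x0 y) even_add.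
  by case: e => -> //; rewrite even_add // /evenv weight_onev.
have wX : {in X &, forall y z, y != z -> weight (addv y z) = 4}.
  move=> y z yX zX yz; have := yX; have := zX; rewrite !inE => /andP[z0 zI] /andP[y0 yI].
  have := nI (pairS (addv x0 y)); rewrite yI => /forallP/(_ (pairS (addv x0 z))).
  rewrite zI /= => nadj.
  have e : addv (addv x0 y) (addv x0 z) = addv y z.
    by rewrite (bvaddC x0) -bvaddA bvaddK.
  have : ~~ ((weight (addv y z) == 2) || (weight (addv (addv y z) onev) == 2)).
    apply: contra nadj => h; apply/existsP; exists (addv x0 y); rewrite mem_pairS /=.
    by apply/existsP; exists (addv x0 z); rewrite mem_pairS /= e.
  rewrite negb_or => /andP[w2 w6].
  apply: weight4 => //; first by rewrite ffunE (negPf y0) (negPf z0).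
    by rewrite even_add ?evX.
  apply: contra yz => /eqP yz; apply/eqP.
  by rewrite -[z](bvaddK y) yz; apply/ffunP => i; rewrite !ffunE nth_nseq if_same addbF.
have addv0 y : addv y (wv zerow) = y.
  by apply/ffunP => i; rewrite !ffunE nth_nseq if_same addbF.
have zX : wv zerow \in X by rewrite inE addv0 -eS0 S0I ffunE.
have [zw uw /allP w8] := weight4_words_ok.
(* Filtering the fixed list makes [L] a subsequence of it, as [cliquesP] requires. *)
pose L := [seq w <- weight4_words | wv w \in X].
have LX w : w \in L -> [/\ w \in weight4_words, size w = 8 & wv w \in X].
  by rewrite /L mem_filter => /andP[wX' h]; split=> //; apply/eqP; exact: w8.
have eX : X = ws (zerow :: L).
  apply/setP => y; rewrite [RHS]inE in_cons; apply/idP/orP => [yX|[/eqP e|/LX[_ _]]].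
  - have [->|yz] := eqVneq y (wv zerow); first by left; rewrite wvK.
    right; rewrite /L mem_filter bwK yX; apply: mem_weight4_words.
      by move: yX; rewrite inE => /andP[].
    by rewrite -(wX _ _ yX zX yz) addv0.
  - by rewrite -(bwK y) e.
  - by rewrite bwK.
have uL : uniq (zerow :: L).
  by rewrite cons_uniq filter_uniq // andbT mem_filter (negPf zw) andbF.
have sL : size L = 7.
  have h : all (fun w => size w == 8) (zerow :: L).
    by rewrite [X in is_true X]andTb; apply/allP => w /LX[_ -> _].
  by have := card_ws uL h; rewrite -eX cX => -[].
have pL : pairwise adj4 L.
  apply: uniq_pairwise_rel => [|w u /LX[_ w8' wX'] /LX[_ u8 uX] wu].
    by move: uL; rewrite cons_uniq => /andP[].
  rewrite /adj4 -(wvK w8') -(wvK u8) -bw_add -weight_bw wX //.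
  by apply: contra wu => /eqP /wv_inj -> //; rewrite inE ?w8' ?u8.
have := cliquesP (filter_subseq _ _ : subseq L weight4_words) pL; rewrite sL => Lc.
have /allP/(_ _ Lc)/hasP[b _ /hasP[p]] := clique_checkT.
rewrite mem_iota => /andP[_ p15] /andP[/allP h1 /allP h2].
exists b, (Ordinal p15), x0; split=> //.
have {}eX : X = ws (code b p).
  by rewrite eX; apply/setP => y; rewrite inE [RHS]inE; apply/idP/idP; [exact: h1|exact: h2].
rewrite eI eX; apply/setP => S; apply/imsetP/imsetP => -[y]; rewrite inE.
  by move=> yc ->; exists y => //; rewrite inE mem_cat yc.
(* Complemented code words give no new vertices. *)
rewrite mem_cat => /orP[yc|/mapP[w wc e]] ->; first by exists y; first by rewrite inE; exact: yc.
have ey : bw (addv onev y) = w.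
  by rewrite bw_onev e /compw (mapK negbK).
exists (addv onev y); first by rewrite inE ey.
by rewrite bvaddCA pairS_onev.
Qed.

(** The listed words start with 0, so [pairS] is injective on them and common points can be counted
    on words. *)
Lemma Jm_card b v w : #|Jm b v :&: Jm b w| =
  count (fun u => u \in code_coset b (nv w)) (code_coset b (nv v)).
Proof.
have bin : b \in [:: false; true] by case: b.
have chk u := allP (allP code_checkT _ bin) _ (nv_mverts u).
have hd u y : y \in ws (code_coset b (nv u)) -> ~~ y ord0.
  rewrite inE => h; have /andP[_ /allP/(_ _ h) /andP[_]] := chk u.
  by rewrite -(nth_bw y ord0); case: (bw y).
rewrite /Jm -imsetI; last first.
  by move=> x y /hd hx /hd hy; apply: pairS_inj.
have /andP[uv /allP sv] := chk v.
rewrite card_in_imset; last first.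
  by move=> x y; rewrite !(in_setI) => /andP[/hd hx _] /andP[/hd hy _]; apply: pairS_inj.
rewrite -size_filter -card_ws ?filter_uniq //.
  by apply: eq_card => y; rewrite in_setI !in_ws mem_filter andbC.
by apply/allP => u; rewrite mem_filter => /andP[_ /sv /andP[]].
Qed.

(** The group preserves the class, so the orbit lies among the 120 tabulated cosets of one class,
    and its size forces equality. *)
Lemma gamma_isomorphic_model I0 : indep8 I0 -> #|orbitG I0| = 120 ->
  isomorphic (medge no_sign) (complement (@Gamma1_adj I0)).
Proof.
move=> /indep8_code[b cI0] c120.
have chk v w := allP (allP (inter_checkT b) _ (map_f (fun v => (v, code_coset b v))
  (nv_mverts v))) _ (map_f (fun v => (v, code_coset b v)) (nv_mverts w)).
have J8 v : #|Jm b v| = 8.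
  rewrite -[Jm b v]setIid Jm_card; have /andP[_] := chk v v.
  by rewrite eqxx => /eqP.
have sub : orbitG I0 \subset [set Jm b v | v in V].
  apply/subsetP => _ /imsetP[[s t] + ->]; rewrite inE => /andP[os et].
  have [v ->] := in_class_Jm (gact_class os et cI0).
  exact: imset_f.
have eO : orbitG I0 = [set Jm b v | v in V].
  apply/eqP; rewrite eqEcard sub c120; apply: leq_trans (leq_imset_card _ _) _.
  by rewrite card_prod !card_ord.
have inO v : Jm b v \in orbitG I0 by rewrite eO; exact: imset_f.
pose f v : Gamma1 I0 := Sub (Jm b v) (inO v).
apply: (@twinless_surjection _ _ _ f srg_gamma_model).
  case=> J hJ; have /imsetP[v _ e] : J \in [set Jm b v | v in V] by rewrite -eO.
  exists v.
  by apply: val_inj; rewrite /= e.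
move=> v w; have /andP[/eqP + _] := chk v w.
rewrite -[madj _ _ _]/(medge no_sign v w) => ->.
rewrite -Jm_card /complement /Gamma1_adj -val_eqE /= andbC; congr (_ && _).
have [->|h] := eqVneq (Jm b v) (Jm b w); first by rewrite setIid J8.
(* If all eight points are common, both sets equal their intersection. *)
apply: contra h => /eqP h; apply/eqP.
have e u : u \in [:: v; w] -> Jm b v :&: Jm b w = Jm b u.
  rewrite !inE => uvw; apply/eqP; rewrite eqEcard h J8 leqnn andbT.
  by case/orP: uvw => /eqP ->; rewrite ?subsetIl ?subsetIr.
by rewrite -(e v) ?(e w) // !inE eqxx ?orbT.
Qed.

Theorem theorem3p13 (I0 : {set {set bvec}}) :
  indep8 I0 -> #|orbitG I0| = 120 ->
  [/\ strongly_regular GE8_adj,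
      strongly_regular (complement (@Gamma1_adj I0)),
      quantum_isomorphic GE8_adj (complement (@Gamma1_adj I0)) &
      ~ isomorphic GE8_adj (complement (@Gamma1_adj I0))].
Proof.
move=> iI0 cI0; have isoE := e8_isomorphic_model.
have isoG := gamma_isomorphic_model iI0 cI0.
split.
- by exists 120, 63, 30, 36; exact: srg_isomorphic (isomorphic_sym isoE) srg_e8_model.
- by exists 120, 63, 30, 36; exact: srg_isomorphic (isomorphic_sym isoG) srg_gamma_model.
- exact: quantum_isomorphic_transport (isomorphic_sym isoE) (isomorphic_sym isoG)
    model_quantum_isomorphic.
move=> isoEG.
(* The composite is an isomorphism between the models; pulling the exceptional pair back along it
   would provide a third vertex for that pair. *)
have [f [bf ef]] := isomorphic_trans (isomorphic_trans isoE isoEG) (isomorphic_sym isoG).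
have [x [y [xy nxy no_third]]] := gamma_model_no_third.
have [g fK gK] := bf; apply: no_third.
rewrite -(gK x) -(gK y); apply: (third_vertex_iso bf ef); apply: e8_model_third.
  by rewrite -(inj_eq (bij_inj bf)) !gK.
by rewrite ef !gK.
Qed.
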